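(* Let $R\in M_d(\mathbb{Z})$ be expansive, let $B\subset\mathbb{Z}^d$ be a simple digit set for $R$, and suppose that $(R,B)$ satisfies the almost-Parseval-frame condition. Let $\mu=\mu(R,B)$ and suppose that $\mathcal{Z}:=\{\xi\in\mathbb{R}^d:\widehat\mu(\xi+k)=0\text{ for all }k\in\mathbb{Z}^d\}$ is empty. Then $\mu$ admits a Fourier frame $E(\Lambda)=\{e^{2\pi i\langle\lambda,x\rangle}:\lambda\in\Lambda\}$ with $\Lambda\subset\mathbb{Z}^d$.
   Context: A matrix is expansive if all its eigenvalues have modulus $>1$. A finite set $B\subset\mathbb{Z}^d$ is a simple digit set for $R$ if distinct elements of $B$ are not congruent modulo $R(\mathbb{Z}^d)$. Let $N=\#B$ and $B_n=\{\sum_{j=0}^{n-1}R^jb_j:b_j\in B\}$ (so $\#B_n=N^n$). Almost-Parseval-frame condition for $(R,B)$: for every $\epsilon>0$ there exist $n\ge1$ and a subset $J_n\subset\mathbb{Z}^d$ such that $$(1-\epsilon)\sum_{b\in B_n}|w_b|^2\le\sum_{\lambda\in J_n}\left|\frac{1}{\sqrt{N^n}}\sum_{b\in B_n}w_be^{-2\pi i\langle R^{-n}b,\lambda\rangle}\right|^2\le(1+\epsilon)\sum_{b\in B_n}|w_b|^2$$ for all $(w_b)_{b\in B_n}\in\mathbb{C}^{N^n}$. With $\tau_b(x)=R^{-1}(x+b)$, $\mu(R,B)$ is the unique Borel probability measure on $\mathbb{R}^d$ with $\mu(E)=\frac1N\sum_{b\in B}\mu(\tau_b^{-1}(E))$ for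 all Borel $E$; $\widehat\mu(\xi)=\int e^{-2\pi i\langle\xi,x\rangle}d\mu(x)$. $E(\Lambda)$ is a Fourier frame for $\mu$ if there are constants $0<A\le A'<\infty$ with $A\|f\|^2\le\sum_{\lambda\in\Lambda}|\int f(x)e^{-2\pi i\langle\lambda,x\rangle}d\mu(x)|^2\le A'\|f\|^2$ for all $f\in L^2(\mu)$ (norm of $L^2(\mu)$). *)

(* Defs.v *)
From HB Require Import structures.
From mathcomp Require Import all_boot all_order all_algebra.
From mathcomp Require Import finmap.
From mathcomp Require Import all_classical all_reals all_analysis.
From mathcomp Require Import complex.

Set Implicit Arguments.
Unset Strict Implicit.
Unset Printing Implicit Defensive.

Import Order.TTheory GRing.Theory Num.Theory.
Import numFieldNormedType.Exports.

Local Open Scope classical_set_scope.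
Local Open Scope fset_scope.
Local Open Scope complex_scope.
Local Open Scope ring_scope.

(* R^d with the sigma-algebra generated by its open sets. *)
Definition borel (R : realType) (d : nat) : measurableType _ :=
  g_sigma_algebraType (@open 'cV[R]_d).

Definition zvec (R : realType) (d : nat) (k : 'cV[int]_d) : 'cV[R]_d :=
  map_mx intr k.

Definition zmat (R : realType) (d : nat) (M : 'M[int]_d) : 'M[R]_d :=
  map_mx intr M.

Definition dot (R : realType) (d : nat) (x y : 'cV[R]_d) : R :=
  \sum_(i < d) x i ord0 * y i ord0.

(* exp (- 2 pi i <xi, x>) *)
Definition character (R : realType) (d : nat) (xi x : 'cV[R]_d) : R[i] :=
  cos (- (2 * pi * dot xi x)) +i* sin (- (2 * pi * dot xi x)).

(* Squared modulus, as a real number. *)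
Definition normc2 (R : realType) (z : R[i]) : R :=
  ComplexField.Normc.normc z ^+ 2.

(* eigenvalue is the library's left-eigenvalue predicate; a square matrix has
   the same left and right eigenvalues. *)
Definition expansive (R : realType) (d : nat) (M : 'M[int]_d) : Prop :=
  forall z : R[i], eigenvalue (map_mx intr M : 'M[R[i]]_d) z -> 1 < `|z|.

Definition simple_digit_set (d : nat) (M : 'M[int]_d)
    (B : {fset 'cV[int]_d}) : Prop :=
  forall b b' : 'cV[int]_d, b \in B -> b' \in B ->
    (exists k : 'cV[int]_d, b - b' = M *m k) -> b = b'.

Definition iterated_digits (d : nat) (M : 'M[int]_d) (B : {fset 'cV[int]_d})
    (n : nat) : {fset 'cV[int]_d} :=
  [fset \sum_(j < n) (M ^+ j *m val (c j)) | c : {ffun 'I_n -> B}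
     in {ffun 'I_n -> B}].

Definition almost_parseval_frame (R : realType) (d : nat) (M : 'M[int]_d)
    (B : {fset 'cV[int]_d}) : Prop :=
  forall eps : R, 0 < eps ->
  exists (n : nat) (J : set 'cV[int]_d), (1 <= n)%N /\
  forall w : 'cV[int]_d -> R[i],
    let Bn := iterated_digits M B n in
    let W := \sum_(b <- Bn) normc2 (w b) in
    let S := (\esum_(l in J)
      (normc2 ((Num.sqrt ((#|` B| ^ n)%N%:R))^-1%:C *
        \sum_(b <- Bn) w b *
          character (invmx (zmat R M ^+ n) *m zvec R b) (zvec R l)))%:E)%E in
    (((1 - eps) * W)%:E <= S)%E /\ (S <= ((1 + eps) * W)%:E)%E.

Definition tau (R : realType) (d : nat) (M : 'M[int]_d) (b : 'cV[int]_d)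
    (x : 'cV[R]_d) : 'cV[R]_d :=
  invmx (zmat R M) *m (x + zvec R b).

Definition self_affine (R : realType) (d : nat) (M : 'M[int]_d)
    (B : {fset 'cV[int]_d}) (mu : probability (borel R d) R) : Prop :=
  forall E : set (borel R d), measurable E ->
    (mu E = (#|` B|%:R^-1)%:E * \sum_(b <- B) mu (@tau R d M b @^-1` E))%E.

Definition cintegral (R : realType) (d : nat) (mu : probability (borel R d) R)
    (f : 'cV[R]_d -> R[i]) : R[i] :=
  Rintegral mu setT (fun x => complex.Re (f x)) +i*
  Rintegral mu setT (fun x => complex.Im (f x)).

Definition fourier (R : realType) (d : nat) (mu : probability (borel R d) R)
    (xi : 'cV[R]_d) : R[i] :=
  cintegral mu (character xi).

Definition periodic_zeros (R : realType) (d : nat)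
    (mu : probability (borel R d) R) : set 'cV[R]_d :=
  [set xi | forall k : 'cV[int]_d, fourier mu (xi + zvec R k) = 0].

Definition sqnorm (R : realType) (d : nat) (mu : probability (borel R d) R)
    (f : 'cV[R]_d -> R[i]) : \bar R :=
  (\int[mu]_x (normc2 (f x))%:E)%E.

Definition square_integrable (R : realType) (d : nat)
    (mu : probability (borel R d) R) (f : 'cV[R]_d -> R[i]) : Prop :=
  [/\ measurable_fun [set: borel R d] (fun x => complex.Re (f x)),
      measurable_fun [set: borel R d] (fun x => complex.Im (f x))
    & (sqnorm mu f < +oo)%E].

Definition fourier_frame (R : realType) (d : nat)
    (mu : probability (borel R d) R) (L : set 'cV[R]_d) : Prop :=
  exists a a' : R, [/\ 0 < a, a <= a' &
    forall f : 'cV[R]_d -> R[i], square_integrable mu f ->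
    let S := (\esum_(l in L)
      (normc2 (cintegral mu (fun x => (f x * character l x)%R)))%:E)%E in
    (a%:E * sqnorm mu f <= S)%E /\ (S <= a'%:E * sqnorm mu f)%E].

(* Main.v *)
(* Since the zero set of the periodised transform is empty, compactness of the
   unit cube and uniform continuity of the Fourier transform give delta, rho > 0
   such that every xi has an integer translate near which |mu^|^2 >= delta, on a
   ball of radius rho.  A frequency set J of an almost-Parseval frame for B_n may
   be translated so that it contains 0, and its elements may be moved by R^T^n Z^d
   without changing the frame inequalities; products of such frames are frames for
   (R, B_(m + n)).  Choosing the levels and shifts inductively yields an increasing
   sequence of finite L_k, frames for B_(m_k) with constants 1/2 and 3/2, such that
   |mu^(R^T^(-m_k) l)|^2 >= delta on L_k; the frame set is the union of the L_k.

   No separation of the pieces of the attractor is needed.  Upper bound: by self-affinity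
   the coefficient of f at l is the mu-average over x of the finite transform of
   b |-> f (R^(-n) (x + b)), so Jensen's inequality and the discrete upper bound
   suffice.  Lower bound: for large n, f (R^(-n) (x + b)) is close in mean square
   to a function w b not depending on x; for such weights the coefficient is the
   finite transform of w times mu^(R^T^(-n) l), and the discrete lower bound
   applies. *)
Require Import Defs.
From HB Require Import structures.
From mathcomp Require Import all_boot all_order all_algebra.
From mathcomp Require Import finmap.
From mathcomp Require Import all_classical all_reals all_analysis.
From mathcomp Require Import measurable_realfun.
From mathcomp Require Import complex ring lra zify.
Set Implicit Arguments.
Unset Strict Implicit.
Unset Printing Implicit Defensive.
Import Order.TTheory GRing.Theory Num.Theory.
Import numFieldNormedType.Exports.
Local Open Scope classical_set_scope.
Local Open Scope ring_scope.

(** Frames are lists with multiplicity, so that the product of two frames is the list of all sums of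
    their frequencies, with multiplied constants. Repetitions are excluded afterwards by an upper
    constant below 2, which 3/2 provides; this is what lets the union of the lists be treated as a
    set.

    A product frequency at level m + n is l + R^T^m (l1 + R^T^n t), and R^T^(-(m+n)) maps it to y +
    R^T^(-n) l1 + t with y = R^T^(-(m+n)) l. The integer vector t is free and is chosen from l1
    alone, so that |mu^|^2 is at least delta on the ball of radius rho around R^T^(-n) l1 + t. Since
    the list of the l is finite, a large n brings every y below rho at once.

    The mean-square approximation in the lower bound is a good-sets argument. The sets in which
    membership of R^(-n) (x + b) is predicted by b, up to small error for all large n, form a
    sigma-algebra containing the open sets. Self-affinity says that averaging over b gives mu back
    at each level, so a set of small measure spoils few predictions whatever the level. *)

(** * Squared modulus of complex numbers *)

Section SquaredModulus.
Context {R : realType}.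
Implicit Types (z w : R[i]).

Lemma normc2E z : normc2 z = complex.Re z ^+ 2 + complex.Im z ^+ 2.
Proof.
by case: z => a b; rewrite /normc2 /= sqr_sqrtr// addr_ge0// sqr_ge0.
Qed.

Lemma normc2_ge0 z : 0 <= normc2 z.
Proof. by rewrite normc2E addr_ge0// sqr_ge0. Qed.

Lemma normc2M z w : normc2 (z * w) = normc2 z * normc2 w.
Proof. by rewrite !normc2E; case: z => a b; case: w => c e /=; ring. Qed.

(** The right side minus the left side is the squared modulus of [z - 2 * w]. *)
Lemma normc2_le2 z w : normc2 z <= 2 * normc2 w + 2 * normc2 (z - w).
Proof.
rewrite !normc2E; case: z => a b; case: w => c e /=.
have := sqr_ge0 (a - 2 * c); have := sqr_ge0 (b - 2 * e); nra.
Qed.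

Lemma normc2N z : normc2 (- z) = normc2 z.
Proof. by rewrite !normc2E; case: z => a b /=; ring. Qed.

Lemma normc2_0 : normc2 (0 : R[i]) = 0.
Proof. by rewrite normc2E /=; ring. Qed.

Lemma normc2_1 : normc2 (1 : R[i]) = 1.
Proof. by rewrite normc2E /=; ring. Qed.

Lemma normc2_eq0 z : (normc2 z == 0) = (z == 0).
Proof.
rewrite normc2E; case: z => a b /=.
by rewrite paddr_eq0 ?sqr_ge0// !sqrf_eq0 eq_complex.
Qed.

Lemma Re_mul z w : complex.Re (z * w)
  = complex.Re z * complex.Re w - complex.Im z * complex.Im w.
Proof. by case: z => a b; case: w => c e. Qed.

Lemma Im_mul z w : complex.Im (z * w)
  = complex.Re z * complex.Im w + complex.Im z * complex.Re w.
Proof. by case: z => a b; case: w => c e. Qed.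

Lemma Re_add z w : complex.Re (z + w) = complex.Re z + complex.Re w.
Proof. by case: z => a b; case: w => c e. Qed.

Lemma Im_add z w : complex.Im (z + w) = complex.Im z + complex.Im w.
Proof. by case: z => a b; case: w => c e. Qed.

Lemma Re_sub z w : complex.Re (z - w) = complex.Re z - complex.Re w.
Proof. by case: z => a b; case: w => c e. Qed.

Lemma Im_sub z w : complex.Im (z - w) = complex.Im z - complex.Im w.
Proof. by case: z => a b; case: w => c e. Qed.

Lemma normc2C (r : R) : normc2 (r%:C)%C = r ^+ 2.
Proof. by rewrite normc2E /=; ring. Qed.

Lemma complexP z w :
  complex.Re z = complex.Re w -> complex.Im z = complex.Im w -> z = w.
Proof. by case: z => a b; case: w => c e /= -> ->. Qed.
End SquaredModulus.

(** * Characters and integer vectors *)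

Section Characters.
Context {R : realType} {d : nat}.
Implicit Types (x y : 'cV[R]_d) (k l : 'cV[int]_d).

Lemma dotC x y : dot x y = dot y x.
Proof. by apply: eq_bigr => i _; rewrite mulrC. Qed.

Lemma dotDr x y y' : dot x (y + y') = dot x y + dot x y'.
Proof. by rewrite -big_split; apply: eq_bigr => i _; rewrite mxE mulrDr. Qed.

Lemma dotE x y : dot x y = (x^T *m y) ord0 ord0.
Proof. by rewrite mxE; apply: eq_bigr => i _; rewrite mxE. Qed.

Lemma dot_mulmxl (A : 'M[R]_d) x y : dot (A *m x) y = dot x (A^T *m y).
Proof. by rewrite !dotE trmx_mul mulmxA. Qed.

Lemma characterC x y : character x y = character y x.
Proof. by rewrite /character dotC. Qed.

Lemma characterDr x y y' :
  character x (y + y') = character x y * character x y'.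
Proof.
rewrite /character dotDr mulrDr opprD cosD sinD.
by apply/eqP; rewrite eq_complex /=; apply/andP; split; apply/eqP; ring.
Qed.

Lemma characterDl x x' y :
  character (x + x') y = character x y * character x' y.
Proof. by rewrite characterC characterDr !(characterC y). Qed.

Lemma character_mulmxl (A : 'M[R]_d) x y :
  character (A *m x) y = character x (A^T *m y).
Proof. by rewrite /character dot_mulmxl. Qed.

Lemma normc2_character x y : normc2 (character x y) = 1.
Proof. by rewrite normc2E /= cos2Dsin2. Qed.

Lemma character0r x : character x 0 = 1.
Proof.
rewrite /character /dot big1 => [|i _]; last by rewrite mxE mulr0.
by rewrite mulr0 oppr0 cos0 sin0.
Qed.

Lemma cos_2pi_nat n : cos (2 * pi * n%:R : R) = 1.
Proof.
elim: n => [|n ih]; first by rewrite mulr0 cos0.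
have -> : 2 * pi * n.+1%:R = 2 * pi * n%:R + pi *+ 2 :> R.
  by rewrite -[n.+1%:R]natr1 -mulr_natl; ring.
by rewrite cosD2pi.
Qed.

Lemma sin_2pi_nat n : sin (2 * pi * n%:R : R) = 0.
Proof.
elim: n => [|n ih]; first by rewrite mulr0 sin0.
have -> : 2 * pi * n.+1%:R = 2 * pi * n%:R + pi *+ 2 :> R.
  by rewrite -[n.+1%:R]natr1 -mulr_natl; ring.
by rewrite sinD2pi.
Qed.

Lemma zvec_dot k l : dot (zvec R k) (zvec R l) =
  (\sum_i k i ord0 * l i ord0)%:~R.
Proof. by rewrite rmorph_sum; apply: eq_bigr => i _; rewrite !mxE rmorphM. Qed.

Lemma character_zvec k l : character (zvec R k) (zvec R l) = 1.
Proof.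
rewrite /character zvec_dot cosN sinN; case: (\sum_i _) => n.
  by rewrite -pmulrn cos_2pi_nat sin_2pi_nat oppr0.
by rewrite NegzE mulrNz mulrN cosN sinN -pmulrn cos_2pi_nat sin_2pi_nat !oppr0.
Qed.

Lemma zvecD k l : zvec R (k + l) = zvec R k + zvec R l.
Proof. by rewrite /zvec map_mxD. Qed.

Lemma zvecN k : zvec R (- k) = - zvec R k.
Proof. by rewrite /zvec map_mxN. Qed.

Lemma zvec0 : zvec R 0 = 0 :> 'cV[R]_d.
Proof. by rewrite /zvec map_mx0. Qed.

Lemma zvec_mulmx (A : 'M[int]_d) k : zvec R (A *m k) = zmat R A *m zvec R k.
Proof. by rewrite /zvec map_mxM. Qed.

Lemma zmat_mul (A B : 'M[int]_d) : zmat R (A * B) = zmat R A * zmat R B.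
Proof. exact: map_mxM. Qed.

Lemma zmatX (A : 'M[int]_d) n : zmat R (A ^+ n) = zmat R A ^+ n.
Proof.
elim: n => [|n ih]; last by rewrite !exprS zmat_mul ih.
exact: map_mx1.
Qed.

Lemma zmatT (A : 'M[int]_d) : zmat R A^T = (zmat R A)^T.
Proof. by rewrite /zmat map_trmx. Qed.

Lemma zvec_inj : injective (@zvec R d).
Proof.
move=> k l /matrixP kl; apply/matrixP => i j.
by have := kl i j; rewrite !mxE => /intr_inj.
Qed.
End Characters.

(** * Digit expansions in base [M] *)

Section Digits.
Context {d : nat}.
Variables (M : 'M[int]_d) (B : {fset 'cV[int]_d}).
Local Notation D := (iterated_digits M B).

Lemma iterated_digitsP n b : reflect
  (exists c : {ffun 'I_n -> B}, b = \sum_(j < n) (M ^+ j *m val (c j)))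
  (b \in D n).
Proof.
rewrite /iterated_digits; apply: (iffP idP).
  by move=> /imfsetP[/= c _ ->]; exists c.
by move=> [c ->]; apply/imfsetP; exists c.
Qed.

Lemma iterated_digits0 b : (b \in D 0) = (b == 0).
Proof.
apply/iterated_digitsP/eqP => [[c ->]|->]; first by rewrite big_ord0.
suff c : {ffun 'I_0 -> B} by exists c; rewrite big_ord0.
by apply: finfun => -[].
Qed.

Lemma iterated_digitsS n b :
  b \in D n.+1 <-> exists b0 b', [/\ b0 \in B, b' \in D n & b = b0 + M *m b'].
Proof.
split.
  move=> /iterated_digitsP[c ->].
  exists (val (c ord0)), (\sum_(j < n) (M ^+ j *m val (c (lift ord0 j)))).
  split; first exact: valP.
    apply/iterated_digitsP; exists [ffun j => c (lift ord0 j)].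
    by apply: eq_bigr => i _; rewrite ffunE.
  rewrite big_ord_recl mul1mx mulmx_sumr; congr (_ + _).
  by apply: eq_bigr => i _; rewrite mulmxA /= /bump /= add1n exprS.
move=> [b0 [b' [b0B /iterated_digitsP[c ->] ->]]]; apply/iterated_digitsP.
exists [ffun j => if unlift ord0 j is Some i then c i else [` b0B]%fset].
rewrite big_ord_recl mul1mx ffunE unlift_none /= mulmx_sumr; congr (_ + _).
apply: eq_bigr => i _; rewrite mulmxA ffunE liftK.
by rewrite /= /bump /= add1n exprS.
Qed.

Lemma iterated_digitsD m n b : b \in D (m + n)%N <->
  exists b1 b2, [/\ b1 \in D n, b2 \in D m & b = b1 + M ^+ n *m b2].
Proof.
elim: n b => [|n ih] b.
  rewrite addn0; split=> [bD|[b1 [b2 []]]].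
    by exists 0, b; rewrite iterated_digits0 expr0 mul1mx add0r.
  by rewrite iterated_digits0 => /eqP -> ? ->; rewrite expr0 mul1mx add0r.
rewrite addnS iterated_digitsS; split.
  move=> [b0 [b' [b0B /ih[b1 [b2 [b1D b2D ->]]] ->]]].
  exists (b0 + M *m b1), b2; split => //.
    by apply/iterated_digitsS; exists b0, b1.
  by rewrite mulmxDr mulmxA exprS addrA.
move=> [b1 [b2 [/iterated_digitsS[b0 [b' [b0B b'D ->]]] b2D ->]]].
exists b0, (b' + M ^+ n *m b2); split => //; first by apply/ih; exists b', b2.
by rewrite mulmxDr mulmxA exprS addrA.
Qed.

Hypothesis M_inj : forall v : 'cV[int]_d, M *m v = 0 -> v = 0.
Hypothesis B_simple : simple_digit_set M B.

Lemma mulmxX_inj n (v : 'cV[int]_d) : M ^+ n *m v = 0 -> v = 0.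
Proof.
elim: n v => [|n ih] v; first by rewrite expr0 mul1mx.
by rewrite exprS -mulmxA => /M_inj/ih.
Qed.

(** Modulo [M] only the lowest digits survive, so they agree by simplicity; subtracting them and
    cancelling one factor [M] leaves the statement for [n]. *)
Lemma iterated_digits_simple n : simple_digit_set (M ^+ n) (D n).
Proof.
elim: n => [|n ih] b b'.
  by rewrite !iterated_digits0 => /eqP -> /eqP ->.
move=> /iterated_digitsS[b0 [b1 [b0B b1D ->]]].
move=> /iterated_digitsS[b0' [b1' [b0B' b1D' ->]]] [k].
rewrite exprS -mulmxA => e.
have e0 : b0 = b0'.
  apply: B_simple => //; exists (M ^+ n *m k - b1 + b1').
  rewrite mulmxDr mulmxBr -e opprD addrACA -[RHS]addrA [- _ + _]addrC.
  by rewrite -[M *m b1' - M *m b1]opprB addrK.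
subst b0'; congr (_ + M *m _); apply: ih => //; exists k; apply/eqP.
rewrite -subr_eq0; apply/eqP/M_inj.
have e' : M *m (M ^+ n *m k) = M *m b1 - M *m b1'.
  by rewrite -e opprD addrACA subrr add0r.
by rewrite mulmxBr e' mulmxBr subrr.
Qed.

(** [b1] collects the [n] lowest digits and [b2] the [m] highest. Nothing is listed twice because
    [b1] is determined modulo [M ^+ n]; a sum over level [m + n] thus becomes a double sum. *)
Lemma perm_iterated_digitsD m n : perm_eq (D (m + n)%N)
  [seq b1 + M ^+ n *m b2 | b1 <- D n, b2 <- D m].
Proof.
apply: uniq_perm; first exact: fset_uniq.
  apply: allpairs_uniq; [exact: fset_uniq | exact: fset_uniq |].
  move=> [b1 b2] [b1' b2'] /allpairsP[[x1 x2]/= [x1D x2D [-> ->]]].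
  move=> /allpairsP[[y1 y2]/= [y1D y2D [-> ->]]] /= e.
  have exy : x1 - y1 = M ^+ n *m (y2 - x2).
    rewrite mulmxBr; apply/eqP.
    by rewrite subr_eq addrAC -subr_eq opprK e addrC.
  have xy1 : x1 = y1.
    by apply: (@iterated_digits_simple n) => //; exists (y2 - x2).
  move: exy; rewrite xy1 subrr => /esym/mulmxX_inj/eqP.
  by rewrite subr_eq0 => /eqP ->.
move=> b; apply/idP/allpairsP => [/iterated_digitsD[b1 [b2 [? ? ->]]]|].
  by exists (b1, b2).
by move=> [[b1 b2] /= [? ? ->]]; apply/iterated_digitsD; exists b1, b2.
Qed.

Lemma iterated_digits1 : D 1 = B.
Proof.
apply/fsetP => b; apply/idP/idP.
  move=> /iterated_digitsS[b0 [b' [? ]]]; rewrite iterated_digits0.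
  by move=> /eqP -> ->; rewrite mulmx0 addr0.
move=> bB; apply/iterated_digitsS; exists b, 0.
by rewrite iterated_digits0 mulmx0 addr0.
Qed.

End Digits.

(** * Finite frames for the digit sets and their products *)

Section DigitFrames.
Context {R : realType} {d : nat}.
Variables (M : 'M[int]_d) (B : {fset 'cV[int]_d}).
Local Notation D := (iterated_digits M B).
Local Notation Z := (zmat R M).
Local Notation A := (invmx (zmat R M)).
Local Notation N := (#|` B|).
Local Notation chi n b l := (character (A ^+ n *m zvec R b) (zvec R l)).

(* [J] lists the frequencies with multiplicity; the factor [N ^ n] comes from
   omitting the normalisation [1 / sqrt (N ^ n)]. *)
Definition digit_frame (n : nat) (J : seq 'cV[int]_d) (a a' : R) : Prop :=
  forall w : 'cV[int]_d -> R[i],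
  let W := (N ^ n)%:R * \sum_(b <- D n) normc2 (w b) in
  let S := \sum_(l <- J) normc2 (\sum_(b <- D n) w b * chi n b l) in
  a * W <= S <= a' * W.

Lemma digit_frame_weaken n J a a' c c' : c <= a -> a' <= c' ->
  digit_frame n J a a' -> digit_frame n J c c'.
Proof.
move=> ca ac h w; have /andP[lo hi] := h w.
have W0 : 0 <= (N ^ n)%:R * \sum_(b <- D n) normc2 (w b).
  by rewrite mulr_ge0// sumr_ge0// => *; exact: normc2_ge0.
by rewrite /= (le_trans _ lo) ?ler_wpM2r//= (le_trans hi) ?ler_wpM2r.
Qed.

Hypothesis M_unit : Z \in unitmx.
Hypothesis B_simple : simple_digit_set M B.

Lemma zmat_unit_inj (v : 'cV[int]_d) : M *m v = 0 -> v = 0.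
Proof.
move=> Mv0; apply: (@zvec_inj R); rewrite zvec0.
by rewrite -[LHS](mulKmx M_unit) -zvec_mulmx Mv0 zvec0 mulmx0.
Qed.

Lemma mulVXmx n : A ^+ n *m Z ^+ n = 1%:M.
Proof.
elim: n => [|n ih]; first by rewrite !expr0 mul1mx.
by rewrite exprSr exprS -mulmxA [A *m _]mulmxA mulVmx// mul1mx.
Qed.

Lemma mulXVmx n : Z ^+ n *m A ^+ n = 1%:M.
Proof. exact/mulmx1C/mulVXmx. Qed.

Lemma invmxX n : invmx (Z ^+ n) = A ^+ n.
Proof.
have [_ u] := mulmx1_unit (mulVXmx n).
by rewrite -[LHS]mul1mx -(mulVXmx n) mulmxK.
Qed.

(** The extra factor is the character of the two integer vectors [b] and [k], hence 1. *)
Lemma chi_shift n b l k :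
  chi n b (l + (M ^+ n)^T *m k) = chi n b l.
Proof.
rewrite zvecD zvec_mulmx zmatT zmatX characterDr.
rewrite -character_mulmxl mulmxA mulXVmx mul1mx.
by rewrite character_zvec mulr1.
Qed.

Lemma digit_frame_shift n J a a' (s : 'cV[int]_d -> 'cV[int]_d) :
  digit_frame n J a a' ->
  digit_frame n [seq l + (M ^+ n)^T *m s l | l <- J] a a'.
Proof.
move=> h w /=; rewrite big_map.
suff -> : \sum_(l <- J) normc2
      (\sum_(b <- D n) w b * chi n b (l + (M ^+ n)^T *m s l)) =
    \sum_(l <- J) normc2 (\sum_(b <- D n) w b * chi n b l) by exact: (h w).
apply: eq_bigr => l _; congr normc2; apply: eq_bigr => b _.
by rewrite chi_shift.
Qed.

(** Translating the frequencies amounts to multiplying the weights by [chi n b l0], of modulus 1. *)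
Lemma digit_frame_translate n J a a' l0 :
  digit_frame n J a a' -> digit_frame n [seq l + l0 | l <- J] a a'.
Proof.
move=> h w /=; rewrite big_map.
have -> : \sum_(l <- J) normc2 (\sum_(b <- D n) w b * chi n b (l + l0)) =
    \sum_(l <- J) normc2 (\sum_(b <- D n) (w b * chi n b l0) * chi n b l).
  apply: eq_bigr => l _; congr normc2; apply: eq_bigr => b _.
  by rewrite zvecD characterDr; ring.
have -> : \sum_(b <- D n) normc2 (w b) =
    \sum_(b <- D n) normc2 (w b * chi n b l0).
  by apply: eq_bigr => b _; rewrite normc2M normc2_character mulr1.
exact: (h (fun b => w b * chi n b l0)).
Qed.

(** Of the four pairings, that of [b2] with [l'] is an integer and drops out; hence the transform at
    level [m + n] factors into two successive transforms. *)
Lemma chi_combine m n b1 b2 l l' :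
  chi (m + n) (b1 + M ^+ n *m b2) (l + (M ^+ m)^T *m l') =
  chi (m + n) b1 l * chi m b2 l * chi n b1 l'.
Proof.
rewrite zvecD zvec_mulmx zmatX mulmxDr characterDl zvecD !characterDr.
have -> : A ^+ (m + n) *m (Z ^+ n *m zvec R b2) = A ^+ m *m zvec R b2.
  by rewrite exprD -mulmxA [A ^+ n *m _]mulmxA mulVXmx mul1mx.
rewrite zvec_mulmx zmatT zmatX -!character_mulmxl.
rewrite [Z ^+ m *m (A ^+ m *m _)]mulmxA mulXVmx mul1mx character_zvec mulr1.
have -> : Z ^+ m *m (A ^+ (m + n) *m zvec R b1) = A ^+ n *m zvec R b1.
  by rewrite exprD mulmxA [Z ^+ m *m _]mulmxA mulXVmx mul1mx.
ring.
Qed.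

Lemma digit_frame_combine m n J J' a a' c c' : 0 <= c -> 0 <= c' ->
  digit_frame m J a a' -> digit_frame n J' c c' ->
  digit_frame (m + n) [seq l + (M ^+ m)^T *m l' | l <- J, l' <- J']
    (a * c) (a' * c').
Proof.
move=> c0 c'0 hJ hJ' w /=.
have perm := perm_iterated_digitsD zmat_unit_inj B_simple m n.
(* Transform of the high digits at frequency [l]. The phase in front has modulus 1, so [J] controls
   the sum of [normc2 (w1 l b1)] over [l] for fixed [b1], while [J'] applies to the weights [w1 l]
   for fixed [l]. *)
pose w1 l b1 := chi (m + n) b1 l *
  \sum_(b2 <- D m) w (b1 + M ^+ n *m b2) * chi m b2 l.
have -> : \sum_(l <- [seq l + (M ^+ m)^T *m l' | l <- J, l' <- J'])
      normc2 (\sum_(b <- D (m + n)%N) w b * chi (m + n) b l) =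
    \sum_(l <- J) \sum_(l' <- J')
      normc2 (\sum_(b1 <- D n) w1 l b1 * chi n b1 l').
  rewrite big_allpairs_dep; apply: eq_bigr => l _; apply: eq_bigr => l' _.
  congr normc2; rewrite (perm_big _ perm) big_allpairs_dep /=.
  apply: eq_bigr => b1 _; rewrite /w1 mulr_sumr mulr_suml.
  by apply: eq_bigr => b2 _; rewrite chi_combine; ring.
rewrite (perm_big _ perm) big_allpairs_dep /=.
have sw1 : \sum_(l <- J) \sum_(b1 <- D n) normc2 (w1 l b1) =
  \sum_(b1 <- D n) \sum_(l <- J)
    normc2 (\sum_(b2 <- D m) w (b1 + M ^+ n *m b2) * chi m b2 l).
  rewrite exchange_big; apply: eq_bigr => b1 _; apply: eq_bigr => l _.
  by rewrite /w1 normc2M normc2_character mul1r.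
rewrite expnD natrM; apply/andP; split.
  have h : a * ((N ^ m)%:R *
        \sum_(b1 <- D n) \sum_(b2 <- D m) normc2 (w (b1 + M ^+ n *m b2))) <=
      \sum_(b1 <- D n) \sum_(l <- J)
        normc2 (\sum_(b2 <- D m) w (b1 + M ^+ n *m b2) * chi m b2 l).
    rewrite !mulr_sumr; apply: ler_sum => b1 _.
    by have /andP[] := hJ (fun b2 => w (b1 + M ^+ n *m b2)).
  apply: (@le_trans _ _
      (\sum_(l <- J) c * ((N ^ n)%:R * \sum_(b1 <- D n) normc2 (w1 l b1)))).
    rewrite -!mulr_sumr sw1.
    apply: le_trans _ (ler_wpM2l c0 (ler_wpM2l (ler0n _ _) h)).
    by rewrite le_eqVlt; apply/orP; left; apply/eqP; ring.
  by apply: ler_sum => l _; have /andP[] := hJ' (w1 l).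
have h : \sum_(b1 <- D n) \sum_(l <- J)
    normc2 (\sum_(b2 <- D m) w (b1 + M ^+ n *m b2) * chi m b2 l) <=
    a' * ((N ^ m)%:R *
      \sum_(b1 <- D n) \sum_(b2 <- D m) normc2 (w (b1 + M ^+ n *m b2))).
  rewrite !mulr_sumr; apply: ler_sum => b1 _.
  by have /andP[] := hJ (fun b2 => w (b1 + M ^+ n *m b2)).
apply: (@le_trans _ _
    (\sum_(l <- J) c' * ((N ^ n)%:R * \sum_(b1 <- D n) normc2 (w1 l b1)))).
  by apply: ler_sum => l _; have /andP[] := hJ' (w1 l).
rewrite -!mulr_sumr sw1.
apply: le_trans (ler_wpM2l c'0 (ler_wpM2l (ler0n _ _) h)) _.
by rewrite le_eqVlt; apply/orP; left; apply/eqP; ring.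
Qed.

End DigitFrames.

(** * Cardinality, multiplicity and existence of finite frames *)

Lemma not_uniq_perm (T : eqType) (s : seq T) : ~~ uniq s ->
  exists x s', perm_eq s [:: x, x & s'].
Proof.
elim: s => [|y s ih]//=; rewrite negb_and negbK => /orP[ys|/ih[x [s' ps]]].
  by exists y, (rem y s); rewrite perm_cons perm_to_rem.
exists x, (y :: s'); rewrite (perm_trans (y := [:: y, x, x & s']))//.
  by rewrite perm_cons.
by apply/permP => a /=; lia.
Qed.

Section DigitFrameProperties.
Context {R : realType} {d : nat}.
Variables (M : 'M[int]_d) (B : {fset 'cV[int]_d}).
Local Notation D := (iterated_digits M B).
Local Notation Z := (zmat R M).
Local Notation A := (invmx (zmat R M)).
Local Notation N := (#|` B|).
Local Notation chi n b l := (character (A ^+ n *m zvec R b) (zvec R l)).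
Hypothesis M_unit : Z \in unitmx.
Hypothesis B_simple : simple_digit_set M B.
Hypothesis B_gt0 : (0 < N)%N.

Lemma card_iterated_digits n : #|` D n| = (N ^ n)%N.
Proof.
elim: n => [|n ih].
  suff -> : D 0 = [fset 0]%fset by rewrite cardfs1.
  by apply/fsetP => b; rewrite iterated_digits0 inE.
have := perm_size (perm_iterated_digitsD (zmat_unit_inj M_unit) B_simple n 1).
rewrite addn1 size_allpairs iterated_digits1 => /= e.
by rewrite expnS -ih -e.
Qed.

Lemma sum_normc2_unit n (w : 'cV[int]_d -> R[i]) :
  (forall b, normc2 (w b) = 1) ->
  \sum_(b <- D n) normc2 (w b) = (N ^ n)%:R.
Proof.
move=> w1; rewrite (eq_bigr (fun=> 1)) => [|b _]; last exact: w1.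
rewrite big_const_seq count_predT card_iterated_digits.
by elim: (N ^ n)%N => //= k ->; rewrite -[k.+1%:R]natr1 addrC.
Qed.

Lemma expN_gt0 n : 0 < (N ^ n)%:R :> R.
Proof. by rewrite ltr0n expn_gt0 B_gt0. Qed.

Lemma digit_frame_neq0 n J (a a' : R) : 0 < a -> digit_frame M B n J a a' ->
  exists l : 'cV[int]_d, l \in J.
Proof.
move=> a0 /(_ (fun=> 1)) /=; case: J => [|l J]; last by exists l; rewrite inE eqxx.
rewrite big_nil sum_normc2_unit => [|b]; last exact: normc2_1.
by move=> /andP[+ _]; rewrite leNgt mulr_gt0// mulr_gt0// expN_gt0.
Qed.

(* Testing the frame on the conjugate of the character of [l] shows that each
   occurrence of [l] costs [1] in the upper bound. *)
Lemma digit_frame_uniq n J (a a' : R) : a' < 2 -> digit_frame M B n J a a' -> uniq J.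
Proof.
move=> a'2 hJ; apply: contraT => /not_uniq_perm[l [J' pJ]].
have := hJ (fun b => chi n b (- l)) => /= /andP[_].
rewrite sum_normc2_unit => [|b]; last exact: normc2_character.
rewrite (perm_big _ pJ) !big_cons /=.
rewrite (eq_bigr (fun=> 1)) => [|b _]; last first.
  by rewrite -characterDr -zvecD addNr zvec0 character0r.
have -> : \sum_(b <- D n) (1 : R[i]) = ((N ^ n)%:R%:C)%C.
  rewrite big_const_seq count_predT card_iterated_digits.
  elim: (N ^ n)%N => [|k]; first by rewrite /= rmorph0.
  by rewrite /= => ->; rewrite -[k.+1%:R]natr1 rmorphD rmorph1 addrC.
rewrite normc2C.
have : 0 <= \sum_(l0 <- J') normc2 (\sum_(b <- D n) chi n b (- l) * chi n b l0).
  by apply: sumr_ge0 => l0 _; exact: normc2_ge0.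
have := expN_gt0 n.
set q := (N ^ n)%:R; set S := \sum_(_ <- _) _ => q0 S0 h.
have : 2 * (q * q) <= a' * (q * q) by rewrite -expr2; lra.
by rewrite ler_pM2r ?mulr_gt0// leNgt a'2.
Qed.

(** The upper bound alone forces [J] to be finite, hence a list: for a point mass each frequency
    contributes [(N ^ n)^-1], and the sum is at most [1 + eps]. *)
Lemma almost_parseval_digit_frame (eps : R) : 0 < eps ->
  almost_parseval_frame R M B ->
  exists n J, (1 <= n)%N /\ digit_frame M B n J (1 - eps) (1 + eps).
Proof.
move=> eps0 /(_ _ eps0)[n [J [n1 hJ]]].
have term w (l : 'cV[int]_d) :
    normc2 ((Num.sqrt (N ^ n)%:R)^-1%:C%C * \sum_(b <- D n) w b *
      character (invmx (Z ^+ n) *m zvec R b) (zvec R l)) =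
    (N ^ n)%:R^-1 * normc2 (\sum_(b <- D n) w b * chi n b l).
  by rewrite normc2M normc2C exprVn sqr_sqrtr ?ler0n// invmxX.
have finJ : finite_set J.
  apply: contrapT => Jinf.
  have [b0 b0D] : exists b0, b0 \in D n.
    by apply/fset0Pn; rewrite -cardfs_gt0 card_iterated_digits expn_gt0 B_gt0.
  pose w b : R[i] := (b == b0)%:R.
  have [_] := hJ w; rewrite /=.
  have -> : \sum_(b <- D n) normc2 (w b) = 1.
    rewrite (bigD1_seq b0)//= /w eqxx normc2_1 big1 ?addr0// => b /negbTE ->.
    by rewrite normc2_0.
  rewrite mulr1 (eq_esum (b := fun=> ((N ^ n)%:R^-1)%:E)) => [|l _]; last first.
    rewrite term (bigD1_seq b0)//= big1 => [|b /negbTE b0b]; last first.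
      by rewrite /w b0b mul0r.
    by rewrite addr0 /w eqxx mul1r normc2_character mulr1.
  (* Any [p.+1] frequencies already exceed the upper bound. *)
  pose p := Num.trunc ((1 + eps) * (N ^ n)%:R).
  have [X XJ Xp] := infinite_set_fset p.+1 Jinf.
  apply/negP; rewrite -ltNge.
  apply: (@lt_le_trans _ _ (p.+1%:R * (N ^ n)%:R^-1)%:E).
    rewrite lte_fin ltr_pdivlMr ?expN_gt0//.
    by rewrite truncnS_gt.
  apply: esum_ge; exists [set` X]; first by split => //; exact: finite_fset.
  rewrite fsbig_finite//= set_fsetK big_const_seq count_predT.
  rewrite (_ : iter _ _ _ = ((size X)%:R * (N ^ n)%:R^-1)%:E); last first.
    elim: (size X) => [|k] /=; first by rewrite mul0r.
    by move=> ->; rewrite -EFinD -[k.+1%:R]natr1; congr EFin; ring.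
  by rewrite lee_fin ler_pM2r ?invr_gt0 ?expN_gt0// ler_nat.
exists n, (fset_set J); split => // w.
have := hJ w; rewrite /= esum_fset//; last first.
  by move=> l _; rewrite lee_fin normc2_ge0.
rewrite fsbig_finite// sumEFin !lee_fin (eq_bigr _ (fun l _ => term w l)).
rewrite -mulr_sumr.
move: (expN_gt0 n); set q := _%:R; set W := \sum_(b <- _) _.
set S := \sum_(l <- _) _ => q0 [lo hi]; apply/andP; split.
  by rewrite mulrCA -ler_pdivlMl.
by rewrite mulrCA -ler_pdivrMl.
Qed.

(** The hypothesis gives no control on the level, so levels are raised by products. Two factors with
    [eps / 3] suffice, as [(1 + eps / 3) ^ 2 <= 1 + eps] and [1 - eps <= (1 - eps / 3) ^ 2]. *)
Lemma digit_frame_large (eps : R) p : 0 < eps -> eps < 1 ->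
  almost_parseval_frame R M B ->
  exists n J, (p < n)%N /\ digit_frame M B n J (1 - eps) (1 + eps).
Proof.
move=> + + h; elim: p eps => [|p ih] eps eps0 eps1.
  exact: almost_parseval_digit_frame.
have e0 : 0 < eps / 3 by rewrite divr_gt0.
have e1 : eps / 3 < 1 by lra.
have [n [J [pn hJ]]] := ih _ e0 e1.
have [n' [J' [n'0 hJ']]] := almost_parseval_digit_frame e0 h.
exists (n + n')%N, [seq l + (M ^+ n)^T *m l' | l <- J, l' <- J'].
split; first by lia.
apply: digit_frame_weaken (digit_frame_combine M_unit B_simple _ _ hJ hJ').
- by nra.
- by nra.
- by lra.
- by lra.
Qed.

End DigitFrameProperties.

(** * Powers of the inverse of an expansive matrix *)

Lemma contraction_cvg0 (R : realType) (q : R) (r e : nat -> R) :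
  0 <= q -> q < 1 -> (forall n, 0 <= r n) ->
  (forall n, r n.+1 <= q * r n + e n) ->
  e @ \oo --> 0 -> r @ \oo --> 0.
Proof.
move=> q0 q1 r0 rS e_cvg; apply/cvgrPdist_lt => eps eps0.
(* [eps / 2] is the fixed point of [x |-> q * x + (1 - q) * (eps / 2)]: once the errors are below
   the last term, [r] exceeds [eps / 2] by at most a geometric term. *)
have d0 : 0 < (1 - q) * (eps / 2) by rewrite mulr_gt0 ?subr_gt0 ?divr_gt0.
have /cvgrPdist_lt/(_ _ d0)[K _ hK] := e_cvg.
have bound k : r (K + k)%N <= q ^+ k * r K + eps / 2.
  elim: k => [|k ih]; first by rewrite addn0 expr0 mul1r lerDl ltW// divr_gt0.
  rewrite addnS (le_trans (rS _))//.
  have := hK (K + k)%N (leq_addr _ _); rewrite /= sub0r normrN => /ltW.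
  move=> /(le_trans (ler_norm _)) ek; rewrite exprS.
  have := ler_wpM2l q0 ih; lra.
have : (fun k => r K * q ^+ k) @ \oo --> 0.
  by apply: cvg_geometric; rewrite ger0_norm.
move=> /cvgrPdist_lt/(_ _ (divr_gt0 eps0 (ltr0n _ 2)))[L _ hL].
exists (K + L)%N => // n /= KLn.
have [k -> Lk] : exists2 k, n = (K + k)%N & (L <= k)%N.
  by exists (n - K)%N; lia.
have := hL k Lk; rewrite /= !sub0r !normrN ger0_norm//.
  rewrite ger0_norm//; have := bound k; rewrite mulrC; lra.
by rewrite mulr_ge0// exprn_ge0.
Qed.

Section InversePowers.
Context {R : realType} {d : nat}.
Import ComplexField.Normc.

(* With [u = (MC - z) v], annihilated by the remaining factors, one has
   [AC ^ (n + 1) v = z^-1 (AC ^ n v - AC ^ (n + 1) u)], a contraction up to an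
   error that tends to 0 by induction. *)
Lemma annihilated_cvg0 (MC AC : 'M[R[i]]_d.+1) (zs : seq R[i]) (v : 'cV_d.+1) :
  AC *m MC = 1%:M -> (forall z, z \in zs -> 1 < normc z) ->
  horner_mx MC (\prod_(z <- zs) ('X - z%:P)) *m v = 0 ->
  forall i, (fun n => normc ((AC ^+ n *m v) i ord0)) @ \oo --> 0.
Proof.
move=> AM; elim: zs v => [|z zs ih] v zs1.
  rewrite big_nil rmorph1 mul1mx => -> i.
  under eq_fun do rewrite mulmx0 mxE normc0.
  exact: cvg_cst.
rewrite big_cons mulrC rmorphM /= -mulmxA => h i.
have z1 : 1 < normc z by apply: zs1; rewrite mem_head.
have z0 : z != 0.
  by apply: contraTneq z1 => ->; rewrite normc0 -leNgt ler01.
set u := horner_mx MC ('X - z%:P) *m v in h.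
have {}ih := ih u (fun y yzs => zs1 y (@mem_behead _ (z :: zs) y yzs)) h i.
have u_E : u = MC *m v - z *: v.
  by rewrite /u rmorphB /= horner_mx_X horner_mx_C mulmxBl mul_scalar_mx.
have step n : (AC ^+ n.+1 *m v) i ord0 =
    z^-1 * (AC ^+ n *m v) i ord0 - z^-1 * (AC ^+ n.+1 *m u) i ord0.
  have -> : AC ^+ n.+1 *m u = AC ^+ n *m v - z *: (AC ^+ n.+1 *m v).
    rewrite u_E mulmxBr exprSr -!mulmxA [AC *m (MC *m v)]mulmxA AM mul1mx.
    by rewrite !scalemxAr.
  by move: (AC ^+ n *m v) (AC ^+ n.+1 *m v) => p r; rewrite !mxE mulrBr mulKf// subKr.
apply: (@contraction_cvg0 _ (normc z)^-1 _
    (fun n => (normc z)^-1 * normc ((AC ^+ n.+1 *m u) i ord0))).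
- by rewrite invr_ge0 (le_trans _ (ltW z1)).
- by rewrite invf_lt1// (lt_trans _ z1).
- by move=> n; case: (_ i ord0) => a b; exact: sqrtr_ge0.
- move=> n; rewrite step; apply: le_trans (le_normcD _ _) _.
  by rewrite normcN !normcM normcV.
- rewrite -[X in _ --> X](mulr0 (normc z)^-1); apply: cvgM; first exact: cvg_cst.
  by have := ih; rewrite -(cvg_shiftS (fun n => normc ((AC ^+ n *m u) i ord0))).
Qed.

End InversePowers.

Section Expansive.
Context {R : realType}.
Import ComplexField.Normc.
Local Notation Z M := (zmat R M).
Local Notation A M := (invmx (zmat R M)).
Local Notation zmatC M := (map_mx (intr : int -> R[i]) M).

Lemma zmatCE d (M : 'M[int]_d) : zmatC M = map_mx (real_complex R) (Z M).
Proof. by apply/matrixP => i j; rewrite !mxE rmorph_int. Qed.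

Lemma expansive_root d (M : 'M[int]_d) z : expansive R M ->
  root (char_poly (zmatC M)) z -> 1 < normc z.
Proof.
rewrite -eigenvalue_root_char => h /h.
by case: z => a b; rewrite normc_def -[1]/(1%:C)%C ltcR.
Qed.

Lemma expansive_unit d (M : 'M[int]_d) : expansive R M -> Z M \in unitmx.
Proof.
move=> M_exp; rewrite unitmxE unitfE; apply/negP => /eqP detZ0.
suff /(expansive_root M_exp) : root (char_poly (zmatC M)) 0.
  by rewrite normc0 ltr10.
apply/rootP; rewrite horner_coef0 char_poly_det.
by rewrite zmatCE det_map_mx detZ0 rmorph0 mulr0.
Qed.

(** Over [R[i]] the characteristic polynomial splits into linear factors whose roots have modulus
    above 1, and by Cayley-Hamilton it annihilates every vector; a basis vector selects one column
    of the powers. *)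
Lemma expansive_cvg0 d (M : 'M[int]_d) i j : expansive R M ->
  (fun n => (A M ^+ n) i j) @ \oo --> 0.
Proof.
case: d M i j => [|d] M i j M_exp; first by case: i.
pose AC := map_mx (real_complex R) (A M).
have AM : AC *m zmatC M = 1%:M.
  by rewrite zmatCE -map_mxM mulVmx ?expansive_unit// map_mx1.
have ACX n : AC ^+ n = map_mx (real_complex R) (A M ^+ n).
  by rewrite /AC rmorphXn.
have [zs zsE] := closed_field_poly_normal (char_poly (zmatC M)).
have zs1 z : z \in zs -> 1 < normc z.
  move=> zzs; apply: (expansive_root M_exp).
  rewrite zsE rootZ ?root_prod_XsubC//.
  by rewrite (monicP (char_poly_monic _)) oner_eq0.
pose v : 'cV[R[i]]_d.+1 := delta_mx j ord0.
have hv : horner_mx (zmatC M) (\prod_(z <- zs) ('X - z%:P)) *m v = 0.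
  move: zsE; rewrite (monicP (char_poly_monic _)) scale1r => <-.
  by rewrite Cayley_Hamilton mul0mx.
have := annihilated_cvg0 AM zs1 hv i.
have E n : normc ((AC ^+ n *m v) i ord0) = `|(A M ^+ n) i j|.
  by rewrite /v -colE mxE ACX mxE /= expr0n addr0 sqrtr_sqr.
by under eq_fun do rewrite E; move/norm_cvg0P.
Qed.

(** The powers act on points of space, their transposes on frequencies. *)
Lemma expansive_mulmx_lt d (M : 'M[int]_d) (x : 'cV[R]_d) (e : R) :
  expansive R M -> 0 < e ->
  \forall n \near \oo, `|A M ^+ n *m x| < e /\ `|(A M ^+ n)^T *m x| < e.
Proof.
move=> M_exp e0.
have small (F : nat -> 'M[R]_d) : (forall i j, (fun n => F n i j) @ \oo --> 0) ->
    \forall n \near \oo, `|F n *m x| < e.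
  move=> F0.
  have row i : (fun n => (F n *m x) i ord0) @ \oo --> 0.
    have : (fun n => \sum_j F n i j * x j ord0) @ \oo -->
        \sum_(j < d) 0 * x j ord0.
      apply: (cvg_big (@add_continuous R^o)) => j _.
      by apply: cvgM; [exact: F0 | exact: cvg_cst].
    rewrite big1 => [|j _]; last by rewrite mul0r.
    apply: cvg_trans; apply: near_eq_cvg; near=> n; by rewrite mxE.
  have : \forall n \near \oo, forall i, `|(F n *m x) i ord0| < e.
    apply: filter_forall => i.
    by have /cvgrPdist_lt/(_ _ e0) := row i; under eq_near do rewrite sub0r normrN.
  apply: filterS => n hn; rewrite [X in X < _]mx_normrE; apply/bigmax_ltP.
  by split => // -[i k] _ /=; rewrite ord1.
near=> n; split; near: n; apply: small => i j; first exact: expansive_cvg0.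
under eq_fun do rewrite mxE; exact: expansive_cvg0.
Unshelve. all: by end_near.
Qed.

End Expansive.

(** * Square-integrable functions on a probability space *)

Section SquareIntegrable.
Context {d0 : measure_display} {T : measurableType d0} {R : realType}.
Variable P : probability T R.

(** Constants are integrable for a probability, and [|g| <= 1 + g ^ 2]. *)
Lemma sq_integrable (g : T -> R) : measurable_fun setT g ->
  (\int[P]_x (g x ^+ 2)%:E < +oo)%E -> P.-integrable setT (EFin \o g).
Proof.
move=> mg g2.
have mg2 : measurable_fun setT (fun x => g x ^+ 2) by exact: measurable_funX.
have ig2 : P.-integrable setT (fun x => (g x ^+ 2)%:E).
  apply/integrableP; split; first exact/measurable_EFinP.
  rewrite (eq_integral (fun x => (g x ^+ 2)%:E))// => x _.
  by rewrite gee0_abs// lee_fin sqr_ge0.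
have i1 : P.-integrable setT (fun=> 1%:E).
  by apply/integrableP; split => //; rewrite integral_cst//= normr1 mul1e probability_setT ltry.
apply: (le_integrable _ _ _ (integrableD _ i1 ig2)) => //.
  exact/measurable_EFinP.
move=> x _ /=; rewrite lee_fin [leRHS]ger0_norm; last first.
  by rewrite addr_ge0// sqr_ge0.
rewrite ler_norml; have := sqr_ge0 (g x - 1); have := sqr_ge0 (g x + 1).
rewrite !expr2; have := sqr_ge0 (g x); rewrite expr2.
by move=> *; apply/andP; split; lra.
Qed.

(** The variance is nonnegative: expand the integral of [(g - c) ^ 2], where [c] is the mean of
    [g]. *)
Lemma sq_Rintegral_le (g : T -> R) : measurable_fun setT g ->
  (((Rintegral P setT g) ^+ 2)%:E <= \int[P]_x (g x ^+ 2)%:E)%E.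
Proof.
move=> mg; have [g2|] := ltP (\int[P]_x (g x ^+ 2)%:E)%E (+oo)%E; last first.
  by rewrite leye_eq => /eqP ->; rewrite leey.
have ig := sq_integrable mg g2.
have mg2 : measurable_fun setT (fun x => g x ^+ 2) by exact: measurable_funX.
have ig2 : P.-integrable setT (EFin \o (fun x => g x ^+ 2)).
  apply/integrableP; split; first exact/measurable_EFinP.
  rewrite (eq_integral (fun x => (g x ^+ 2)%:E))// => x _.
  by rewrite gee0_abs// lee_fin sqr_ge0.
have i1 (r : R) : P.-integrable setT (EFin \o (cst r)).
  exact: finite_measure_integrable_cst.
set c := Rintegral P setT g.
have ic : P.-integrable setT (EFin \o (fun x => 2 * c * g x)).
  by have := integrableZl measurableT (2 * c) ig.
have : 0 <= Rintegral P setT (fun x => g x ^+ 2 - 2 * c * g x + c ^+ 2).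
  apply: Rintegral_ge0 => x _; have := sqr_ge0 (g x - c).
  by rewrite sqrrB; lra.
have ib : P.-integrable setT (EFin \o (fun x => g x ^+ 2 - 2 * c * g x)).
  exact: (integrableB measurableT ig2 ic).
rewrite (RintegralD measurableT ib (i1 _)) (RintegralB measurableT ig2 ic).
have icst : Rintegral P setT (cst (c ^+ 2)) = c ^+ 2.
  have : (\int[P]_x cst (c ^+ 2)%:E x = (c ^+ 2)%:E)%E.
    by rewrite integral_cst//= probability_setT mule1.
  by rewrite /Rintegral /= => ->.
rewrite icst (RintegralZl _ measurableT ig) -/c.
rewrite /Rintegral => h; rewrite -[leRHS]fineK; last first.
  by rewrite ge0_fin_numE// integral_ge0// => x _; rewrite lee_fin sqr_ge0.
by rewrite lee_fin; lra.
Qed.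

End SquareIntegrable.

(** * Borel measurability on column vectors *)

Section Borel.
Context {R : realType} {d : nat}.

Lemma mx_norm_lt m n (x : 'M[R]_(m, n)) (e : R) : 0 < e ->
  (forall i j, `|x i j| < e) -> `|x| < e.
Proof.
move=> e0 xe; rewrite [X in X < _]mx_normrE; apply/bigmax_ltP.
by split => // -[i j] _ /=.
Qed.

Lemma cvg_mx (T : Type) (F : set_system T) {FF : Filter F} m n
    (f : T -> 'M[R]_(m, n)) (l : 'M[R]_(m, n)) :
  (forall i j, (fun x => f x i j) @ F --> l i j) -> f @ F --> l.
Proof.
move=> fl; apply/cvgrPdist_lt => e e0.
have : \forall x \near F, forall i j, `|l i j - f x i j| < e.
  apply: filter_forall => i; apply: filter_forall => j.
  by have /cvgrPdist_lt/(_ _ e0) := fl i j.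
by apply: filterS => x h; apply: mx_norm_lt => // i j; rewrite !mxE.
Qed.

Lemma borel_measurable_open (U : set 'cV[R]_d) : open U ->
  measurable (U : set (borel R d)).
Proof. exact: sub_sigma_algebra. Qed.

Lemma continuous_borel_measurable (g : 'cV[R]_d -> 'cV[R]_d) :
  continuous g -> measurable_fun setT (g : borel R d -> borel R d).
Proof.
move=> cg; apply: (@measurability _ _ (borel R d) (borel R d) setT g (@open 'cV[R]_d)) => //.
move=> _ [U oU <-]; rewrite setTI; apply: borel_measurable_open.
by move/continuousP: cg; exact.
Qed.

Lemma continuous_measurable (g : 'cV[R]_d -> R) :
  continuous g -> measurable_fun setT (g : borel R d -> R).
Proof.
move=> cg; apply: (measurability _ (RGenOpens.measurableE R)) => //.
move=> _ [_ [a [b ->] <-]]; rewrite setTI; apply: borel_measurable_open.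
by move/continuousP: cg; apply; exact: interval_open.
Qed.

Lemma continuous_mulmx (A : 'M[R]_d) (b : 'cV[R]_d) :
  continuous (fun x : 'cV[R]_d => A *m (x + b)).
Proof.
move=> x; apply: (@cvg_mx _ (nbhs x)) => i j.
under eq_fun do rewrite mxE; rewrite mxE.
apply: (cvg_big (@add_continuous R^o)) => k _.
apply: cvgM; first exact: cvg_cst.
under eq_fun do rewrite mxE; rewrite mxE.
by apply: cvgD; [exact: coord_continuous|exact: cvg_cst].
Qed.

Lemma continuous_dot (y : 'cV[R]_d) :
  continuous (fun x : 'cV[R]_d => dot y x : R).
Proof.
move=> x.
apply: (@cvg_big _ _ _ _ _ (@add_continuous R^o) _ (nbhs x)) => k _.
by apply: cvgM; [exact: cvg_cst|exact: coord_continuous].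
Qed.

Definition cmeasurable (f : 'cV[R]_d -> R[i]) : Prop :=
  measurable_fun [set: borel R d] (fun x => complex.Re (f x)) /\
  measurable_fun [set: borel R d] (fun x => complex.Im (f x)).

Lemma cmeasurable_cst (c : R[i]) : cmeasurable (fun=> c).
Proof. by split; exact: measurable_cst. Qed.

Lemma cmeasurableD f g : cmeasurable f -> cmeasurable g ->
  cmeasurable (fun x => f x + g x).
Proof.
move=> [fr fi] [gr gi]; split.
  by under eq_fun do rewrite Re_add; exact: measurable_funD.
by under eq_fun do rewrite Im_add; exact: measurable_funD.
Qed.

Lemma cmeasurableM f g : cmeasurable f -> cmeasurable g ->
  cmeasurable (fun x => f x * g x).
Proof.
move=> [fr fi] [gr gi]; split.
  by under eq_fun do rewrite Re_mul; apply: measurable_funB; exact: measurable_funM.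
by under eq_fun do rewrite Im_mul; apply: measurable_funD; exact: measurable_funM.
Qed.

Lemma cmeasurableB f g : cmeasurable f -> cmeasurable g ->
  cmeasurable (fun x => f x - g x).
Proof.
move=> [fr fi] [gr gi]; split.
  by under eq_fun do rewrite Re_sub; exact: measurable_funB.
by under eq_fun do rewrite Im_sub; exact: measurable_funB.
Qed.

Lemma cmeasurable_sum (I : Type) (s : seq I) (F : I -> 'cV[R]_d -> R[i]) :
  (forall i, cmeasurable (F i)) -> cmeasurable (fun x => \sum_(i <- s) F i x).
Proof.
move=> mF; elim: s => [|i s ih].
  by under eq_fun do rewrite big_nil; exact: cmeasurable_cst.
by under eq_fun do rewrite big_cons; exact: cmeasurableD.
Qed.

Lemma cmeasurable_character (y : 'cV[R]_d) : cmeasurable (character y).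
Proof.
have m : measurable_fun [set: borel R d] (fun x => - (2 * pi * dot y x)).
  have mdot := continuous_measurable (@continuous_dot y).
  by apply: measurable_funN; apply: measurable_funM.
split; first exact: (measurableT_comp (continuous_measurable_fun (@continuous_cos R)) m).
exact: (measurableT_comp (continuous_measurable_fun (@continuous_sin R)) m).
Qed.

Lemma cmeasurable_comp f (g : 'cV[R]_d -> 'cV[R]_d) : continuous g ->
  cmeasurable f -> cmeasurable (f \o g).
Proof.
move=> /continuous_borel_measurable mg [fr fi]; split.
  exact: (measurableT_comp fr mg).
exact: (measurableT_comp fi mg).
Qed.

Lemma measurable_normc2 f : cmeasurable f ->
  measurable_fun [set: borel R d] (fun x => (normc2 (f x))%:E).
Proof.
move=> [fr fi]; apply/measurable_EFinP.
under eq_fun do rewrite normc2E.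
by apply: measurable_funD; exact: measurable_funX.
Qed.

End Borel.

(** * Integration against a measure that averages its own pushforwards *)

Section PushforwardAverage.
Context {d0 : measure_display} {T : measurableType d0} {R : realType}.
Variable mu : {measure set T -> \bar R}.

Lemma ge0_integral_pushforward_sum (I : Type) (s : seq I) (phi : I -> T -> T)
    (c : {nonneg R}) (f : T -> \bar R) :
  (forall i, measurable_fun setT (phi i)) ->
  (forall E, measurable E ->
    mu E = (c%:num%:E * \sum_(i <- s) mu (phi i @^-1` E))%E) ->
  (forall x, 0 <= f x)%E -> measurable_fun setT f ->
  (\int[mu]_x f x = c%:num%:E * \sum_(i <- s) \int[mu]_x f (phi i x))%E.
Proof.
(* [nth] needs a default element, so the empty list, for which [mu] vanishes, is treated apart. *)
move=> mphi muE f0 mf; case: s => [|i0 s'] in muE *.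
  have mu0 E : measurable E -> mu E = 0%E by move=> /muE; rewrite big_nil mule0.
  rewrite big_nil mule0 (@eq_measure_integral _ _ _ setT mzero) ?integral_measure_zero//.
  by move=> E mE _; rewrite mu0.
set s := i0 :: s' in muE *.
pose psi (k : nat) := phi (nth i0 s k).
have mpsi k : measurable_fun setT (psi k) by exact: mphi.
pose m_ (k : nat) : {measure set T -> \bar R} :=
  [the {measure set T -> \bar R} of pushforward mu (psi k)].
rewrite (@eq_measure_integral _ _ _ setT (mscale c (msum (m_ mpsi) (size s)))).
  rewrite ge0_integral_mscale// ge0_integral_measure_sum//.
  congr (_ * _)%E; rewrite (big_nth i0) big_mkord; apply: eq_bigr => k _.
  by rewrite ge0_integral_pushforward.
move=> E mE _; rewrite muE// /mscale /msum (big_nth i0) big_mkord.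
by congr (_ * _)%E; apply: eq_bigr.
Qed.

(** In a sum of nonnegative terms with a nonzero factor, no term is infinite when the total is
    finite. *)
Lemma integrable_pushforward_sum (I : eqType) (s : seq I) (phi : I -> T -> T)
    (c : {nonneg R}) (g : T -> R) i :
  (forall i, measurable_fun setT (phi i)) -> c%:num != 0 ->
  (forall E, measurable E ->
    mu E = (c%:num%:E * \sum_(i <- s) mu (phi i @^-1` E))%E) ->
  i \in s -> mu.-integrable setT (EFin \o g) ->
  mu.-integrable setT (EFin \o (g \o phi i)).
Proof.
move=> mphi c0 muE si /integrableP[/measurable_EFinP mg ig].
apply/integrableP; split.
  by apply/measurable_EFinP; exact: measurableT_comp.
move: ig; rewrite (ge0_integral_pushforward_sum mphi muE)//; last first.
  by apply: measurableT_comp => //; exact/measurable_EFinP.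
rewrite (big_rem i)//= => h; rewrite ltey; apply/eqP => e; move: h.
rewrite e addye; first by rewrite gt0_muley ?lte_fin ?lt0r ?c0//= ltxx.
rewrite gt_eqF// (lt_le_trans (ltNyr 0))// sume_ge0// => j _.
by apply: integral_ge0.
Qed.

Lemma Rintegral_pushforward_sum (I : eqType) (s : seq I) (phi : I -> T -> T)
    (c : {nonneg R}) (g : T -> R) :
  (forall i, measurable_fun setT (phi i)) -> c%:num != 0 ->
  (forall E, measurable E ->
    mu E = (c%:num%:E * \sum_(i <- s) mu (phi i @^-1` E))%E) ->
  mu.-integrable setT (EFin \o g) ->
  Rintegral mu setT g = c%:num * \sum_(i <- s) Rintegral mu setT (g \o phi i).
Proof.
move=> mphi c0 muE.
have ge0 (h : T -> R) : (forall x, 0 <= h x) -> mu.-integrable setT (EFin \o h) ->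
    Rintegral mu setT h = c%:num * \sum_(i <- s) Rintegral mu setT (h \o phi i).
  move=> h0 ih; rewrite /Rintegral (ge0_integral_pushforward_sum mphi muE)//.
    rewrite fineM//; last first.
      rewrite big_seq; apply: (big_ind (fun x : \bar R => x \is a fin_num)) => //.
        by move=> x y xf yf; rewrite fin_numD xf.
      move=> i si; exact: (integrable_fin_num measurableT
        (integrable_pushforward_sum mphi c0 muE si ih)).
    rewrite /= [in LHS]big_seq -sum_fine ?[in RHS]big_seq// => i si.
    exact: (integrable_fin_num measurableT
        (integrable_pushforward_sum mphi c0 muE si ih)).
  by case/integrableP : ih.
move=> ig.
have mg : measurable_fun setT g by case/integrableP : ig => /measurable_EFinP.
have bound (h : T -> R) : measurable_fun setT h ->
    (forall x, `|h x| <= `|g x|) -> mu.-integrable setT (EFin \o h).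
  move=> mh hg; apply: le_integrable ig => //; first exact/measurable_EFinP.
  by move=> x _; rewrite /= lee_fin.
(* Positive and negative parts, each dominated by [|g|], reduce the claim to nonnegative
   functions. *)
pose gp x := (`|g x| + g x) / 2; pose gm x := (`|g x| - g x) / 2.
have mp : measurable_fun setT gp.
  apply: measurable_funM => //; apply: measurable_funD => //.
  exact: measurableT_comp.
have mm : measurable_fun setT gm.
  apply: measurable_funM => //; apply: measurable_funB => //.
  exact: measurableT_comp.
have gp0 x : 0 <= gp x.
  by rewrite divr_ge0//; have := ler_norm (- g x); rewrite normrN; lra.
have gm0 x : 0 <= gm x by rewrite divr_ge0// subr_ge0 ler_norm.
have ip : mu.-integrable setT (EFin \o gp).
  apply: bound => // x; rewrite ger0_norm// /gp.
  by have := ler_norm (g x); lra.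
have im : mu.-integrable setT (EFin \o gm).
  apply: bound => // x; rewrite ger0_norm// /gm.
  by have := ler_norm (- g x); rewrite normrN; lra.
have -> : g = (fun x => gp x - gm x).
  by apply/funext => x; rewrite /gp /gm; field.
rewrite RintegralB// (ge0 _ gp0 ip) (ge0 _ gm0 im) -mulrBr -sumrB.
congr (_ * _); rewrite !big_seq; apply: eq_bigr => i si.
by rewrite -RintegralB//; exact: (integrable_pushforward_sum mphi c0 muE si).
Qed.

End PushforwardAverage.

(** * Complex-valued integrals and squared norms *)

Section ComplexIntegral.
Context {R : realType} {d : nat}.
Variable mu : probability (borel R d) R.
Implicit Types f g : 'cV[R]_d -> R[i].

Definition cintegrable f : Prop :=
  mu.-integrable setT (EFin \o (fun x => complex.Re (f x))) /\
  mu.-integrable setT (EFin \o (fun x => complex.Im (f x))).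

Lemma square_integrableP f :
  square_integrable mu f <-> cmeasurable f /\ (sqnorm mu f < +oo)%E.
Proof. by split=> [[]|[[]]]. Qed.

Lemma sqnorm_ge0 f : (0 <= sqnorm mu f)%E.
Proof. by apply: integral_ge0 => x _; rewrite lee_fin normc2_ge0. Qed.

Lemma le_sqnorm f g : cmeasurable f -> cmeasurable g ->
  (forall x, normc2 (f x) <= normc2 (g x)) -> (sqnorm mu f <= sqnorm mu g)%E.
Proof.
move=> mf mg fg; apply: ge0_le_integral => //.
- by move=> x _; rewrite lee_fin normc2_ge0.
- exact: measurable_normc2.
- exact: measurable_normc2.
- by move=> x _; rewrite lee_fin.
Qed.

Lemma sqnorm_cst (c : R[i]) : sqnorm mu (fun=> c) = (normc2 c)%:E.
Proof. by rewrite /sqnorm integral_cst//= probability_setT mule1. Qed.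

Lemma sqnorm_le2 f g : cmeasurable f -> cmeasurable g ->
  (sqnorm mu f <= 2%:E * sqnorm mu g + 2%:E * sqnorm mu (fun x => (f x - g x)%R))%E.
Proof.
move=> mf mg; have mfg := cmeasurableB mf mg.
have mZ h : cmeasurable h ->
    measurable_fun [set: borel R d] (fun x => (2%:E * (normc2 (h x))%:E)%E).
  by move=> mh; apply: emeasurable_funM => //; exact: measurable_normc2.
have h0 h x : (0 <= 2%:E * (normc2 (h x : R[i]))%:E)%E.
  by rewrite mule_ge0// lee_fin ?normc2_ge0.
rewrite /sqnorm -!ge0_integralZl//; last 4 first.
- exact: measurable_normc2.
- by move=> x _; rewrite lee_fin normc2_ge0.
- exact: measurable_normc2.
- by move=> x _; rewrite lee_fin normc2_ge0.
rewrite -ge0_integralD//; [|exact: mZ|exact: mZ].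
apply: ge0_le_integral => //.
- by move=> x _; rewrite lee_fin normc2_ge0.
- exact: measurable_normc2.
- by apply: emeasurable_funD; exact: mZ.
- by move=> x _; rewrite -!EFinM -EFinD lee_fin normc2_le2.
Qed.

(** Jensen's inequality for the real and the imaginary part, added up. *)
Lemma normc2_cintegral_le f : cmeasurable f ->
  ((normc2 (cintegral mu f))%:E <= sqnorm mu f)%E.
Proof.
move=> [fr fi]; rewrite normc2E /= EFinD.
apply: (le_trans (leeD (sq_Rintegral_le mu fr) (sq_Rintegral_le mu fi))).
rewrite -ge0_integralD//.
- by apply: ge0_le_integral => //; last (by move=> x _; rewrite normc2E EFinD);
   by [move=> x _; rewrite -EFinD lee_fin addr_ge0// sqr_ge0 |
       apply: emeasurable_funD; apply/measurable_EFinP; exact: measurable_funX |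
       exact: measurable_normc2].
- by move=> x _; rewrite lee_fin sqr_ge0.
- by apply/measurable_EFinP; exact: measurable_funX.
- by move=> x _; rewrite lee_fin sqr_ge0.
- by apply/measurable_EFinP; exact: measurable_funX.
Qed.

Lemma square_integrable_cintegrable f :
  square_integrable mu f -> cintegrable f.
Proof.
move=> [fr fi foo]; split; apply: sq_integrable => //;
  apply: le_lt_trans foo; apply: ge0_le_integral => //.
- by move=> x _; rewrite lee_fin sqr_ge0.
- by apply/measurable_EFinP; exact: measurable_funX.
- exact: measurable_normc2.
- by move=> x _; rewrite lee_fin normc2E lerDl sqr_ge0.
- by move=> x _; rewrite lee_fin sqr_ge0.
- by apply/measurable_EFinP; exact: measurable_funX.
- exact: measurable_normc2.
- by move=> x _; rewrite lee_fin normc2E lerDr sqr_ge0.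
Qed.

Lemma square_integrableM1 f g : square_integrable mu f -> cmeasurable g ->
  (forall x, normc2 (g x) = 1) -> square_integrable mu (fun x => f x * g x).
Proof.
move=> /square_integrableP[mf foo] mg g1; apply/square_integrableP.
split; first exact: cmeasurableM.
apply: le_lt_trans foo; apply: le_sqnorm => //; first exact: cmeasurableM.
by move=> x; rewrite normc2M g1 mulr1.
Qed.

Lemma square_integrable_character (xi : 'cV[R]_d) :
  square_integrable mu (character xi).
Proof.
apply/square_integrableP; split; first exact: cmeasurable_character.
apply: (@le_lt_trans _ _ (sqnorm mu (fun=> 1))).
  apply: le_sqnorm; [exact: cmeasurable_character | exact: cmeasurable_cst |].
  by move=> x; rewrite normc2_character normc2_1.
by rewrite sqnorm_cst ltry.
Qed.

Lemma cintegrableD f g : cintegrable f -> cintegrable g ->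
  cintegrable (fun x => f x + g x).
Proof.
move=> [fr fi] [gr gi]; split.
  by under eq_fun do rewrite Re_add; exact: (integrableD measurableT fr gr).
by under eq_fun do rewrite Im_add; exact: (integrableD measurableT fi gi).
Qed.

Lemma cintegrableZ (c : R[i]) f : cintegrable f -> cintegrable (fun x => c * f x).
Proof.
move=> [fr fi]; split.
  under eq_fun do rewrite Re_mul.
  exact: (integrableB measurableT (integrableZl measurableT _ fr)
    (integrableZl measurableT _ fi)).
under eq_fun do rewrite Im_mul.
exact: (integrableD measurableT (integrableZl measurableT _ fi)
  (integrableZl measurableT _ fr)).
Qed.

Lemma cintegralD f g : cintegrable f -> cintegrable g ->
  cintegral mu (fun x => f x + g x) = cintegral mu f + cintegral mu g.
Proof.
move=> [fr fi] [gr gi]; apply: complexP.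
  rewrite Re_add /= -RintegralD//.
  by under eq_fun do rewrite Re_add.
rewrite Im_add /= -RintegralD//.
by under eq_fun do rewrite Im_add.
Qed.

Lemma cintegralZ (c : R[i]) f : cintegrable f ->
  cintegral mu (fun x => c * f x) = c * cintegral mu f.
Proof.
move=> [fr fi]; apply: complexP.
  rewrite Re_mul /= -!RintegralZl// -RintegralB//.
  - by under eq_fun do rewrite Re_mul.
  - exact: (integrableZl measurableT _ fr).
  - exact: (integrableZl measurableT _ fi).
rewrite Im_mul /= -!RintegralZl// -RintegralD//.
- by under eq_fun do rewrite Im_mul.
- exact: (integrableZl measurableT _ fi).
- exact: (integrableZl measurableT _ fr).
Qed.

Lemma cintegral0 : cintegral mu (fun=> 0) = 0.
Proof.
by apply: complexP; rewrite /= /Rintegral integral0.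
Qed.

Lemma cintegral_sum (I : eqType) (s : seq I) (F : I -> 'cV[R]_d -> R[i]) :
  (forall i, i \in s -> cintegrable (F i)) ->
  cintegrable (fun x => \sum_(i <- s) F i x) /\
  cintegral mu (fun x => \sum_(i <- s) F i x) = \sum_(i <- s) cintegral mu (F i).
Proof.
elim: s => [_|i s ih iF].
  under eq_fun do rewrite big_nil; rewrite big_nil cintegral0; split => //.
  by apply: square_integrable_cintegrable; apply/square_integrableP;
    split; [exact: cmeasurable_cst | rewrite sqnorm_cst ltry].
have [|s1 s2] := ih; first by move=> j js; apply: iF; rewrite inE js orbT.
have iFi : cintegrable (F i) by apply: iF; rewrite mem_head.
under eq_fun do rewrite big_cons.
by rewrite big_cons -s2 -cintegralD//; split => //; exact: cintegrableD.
Qed.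

End ComplexIntegral.

(** * Self-affinity at level [n] and the upper frame bound *)

Section SelfAffine.
Context {R : realType} {d : nat}.
Variables (M : 'M[int]_d) (B : {fset 'cV[int]_d}).
Variable mu : probability (borel R d) R.
Local Notation D := (iterated_digits M B).
Local Notation Z := (zmat R M).
Local Notation A := (invmx (zmat R M)).
Local Notation N := (#|` B|).
Local Notation chi n b l := (character (A ^+ n *m zvec R b) (zvec R l)).
Hypothesis M_unit : Z \in unitmx.
Hypothesis B_simple : simple_digit_set M B.
Hypothesis mu_MB : self_affine M B mu.

(** For [b] in [D n] this is the composite of [n] maps [tau], the lowest digit of [b] being applied
    innermost and the highest outermost. *)
Definition iterated_map (n : nat) (b : 'cV[int]_d) (x : 'cV[R]_d) : 'cV[R]_d :=
  A ^+ n *m (x + zvec R b).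
Local Notation T := iterated_map.

Lemma continuous_iterated_map n b : continuous (T n b).
Proof. exact: continuous_mulmx. Qed.

Lemma measurable_iterated_map n b :
  measurable_fun [set: borel R d] (T n b : borel R d -> borel R d).
Proof. exact: (continuous_borel_measurable (@continuous_iterated_map n b)). Qed.

Definition digit_weight (n : nat) : {nonneg R} := ((N ^ n)%:R^-1)%:nng.
Local Notation c n := ((N ^ n)%:R^-1 : R).

(** With no digits, self-affinity would make the total mass 0. *)
Lemma B_gt0 : (0 < N)%N.
Proof.
rewrite lt0n; apply/eqP => N0; have := mu_MB measurableT.
by rewrite probability_setT N0 invr0 mul0e => /eqP; rewrite onee_eq0.
Qed.

Lemma digit_weight_neq0 n : (digit_weight n)%:num != 0.
Proof.
by rewrite /= invr_eq0 pnatr_eq0 expn_eq0 negb_and -lt0n B_gt0.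
Qed.

Lemma self_affine_iterated n (E : set (borel R d)) : measurable E ->
  (mu E = (digit_weight n)%:num%:E * \sum_(b <- D n) mu (T n b @^-1` E))%E.
Proof.
elim: n E => [|n ih] E mE.
  suff -> : D 0 = [fset 0]%fset.
    rewrite big_seq_fset1 /= expn0 invr1 mul1e; congr (mu _).
    by apply/seteqP; split => x /=; rewrite /T zvec0 addr0 expr0 mul1mx.
  by apply/fsetP => b; rewrite iterated_digits0 inE.
have mtau b : measurable (@tau R d M b @^-1` E : set (borel R d)).
  rewrite -[X in measurable X]setTI.
  exact: (continuous_borel_measurable (@continuous_mulmx R d A (zvec R b))).
rewrite (mu_MB mE); under eq_bigr do rewrite (ih _ (mtau _)).
rewrite -ge0_sume_distrr => [|b _]; last by apply: sume_ge0.
rewrite muleA -EFinM -invfM -natrM -expnS exchange_big /=.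
have perm := perm_iterated_digitsD (zmat_unit_inj M_unit) B_simple 1 n.
rewrite [D n.+1](_ : _ = D (1 + n)) ?add1n// (perm_big _ perm) /=.
rewrite big_allpairs_dep iterated_digits1; congr (_ * _)%E.
apply: eq_bigr => b' _; apply: eq_bigr => b _.
(* A further [tau] applied outside places its digit [b] above the [n] digits of [b']. *)
have e x : tau M b (T n b' x) = T n.+1 (b' + M ^+ n *m b) x.
  rewrite /tau /T zvecD zvec_mulmx zmatX exprS -!mulmxA; congr (A *m _).
  by rewrite addrA [RHS]mulmxDr [A ^+ n *m (Z ^+ n *m _)]mulmxA mulVXmx// mul1mx.
by congr (mu _); apply/seteqP; split => x /=; rewrite e.
Qed.

Lemma sqnorm_iterated n f : cmeasurable f ->
  (sqnorm mu f =
    (digit_weight n)%:num%:E * \sum_(b <- D n) sqnorm mu (f \o T n b))%E.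
Proof.
move=> mf; rewrite /sqnorm.
rewrite (ge0_integral_pushforward_sum (measurable_iterated_map n)
  (self_affine_iterated n))//.
  by move=> x; rewrite lee_fin normc2_ge0.
exact: measurable_normc2.
Qed.

Lemma cintegral_iterated n f : cintegrable mu f ->
  (forall b, b \in D n -> cintegrable mu (f \o T n b)) /\
  cintegral mu f =
    ((digit_weight n)%:num%:C)%C * \sum_(b <- D n) cintegral mu (f \o T n b).
Proof.
move=> [fr fi]; split.
  move=> b bD; split.
    exact: (integrable_pushforward_sum (measurable_iterated_map n)
      (digit_weight_neq0 n) (self_affine_iterated n) bD fr).
  exact: (integrable_pushforward_sum (measurable_iterated_map n)
      (digit_weight_neq0 n) (self_affine_iterated n) bD fi).
have ReS (s : seq 'cV[int]_d) (F : 'cV[int]_d -> R[i]) :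
    complex.Re (\sum_(b <- s) F b) = \sum_(b <- s) complex.Re (F b).
  elim: s => [|b s ih]; first by rewrite !big_nil.
  by rewrite !big_cons Re_add ih.
have ImS (s : seq 'cV[int]_d) (F : 'cV[int]_d -> R[i]) :
    complex.Im (\sum_(b <- s) F b) = \sum_(b <- s) complex.Im (F b).
  elim: s => [|b s ih]; first by rewrite !big_nil.
  by rewrite !big_cons Im_add ih.
apply: complexP.
  rewrite Re_mul /= mul0r subr0 ReS.
  exact: (Rintegral_pushforward_sum (measurable_iterated_map n)
    (digit_weight_neq0 n) (self_affine_iterated n) fr).
rewrite Im_mul /= mul0r addr0 ImS.
exact: (Rintegral_pushforward_sum (measurable_iterated_map n)
  (digit_weight_neq0 n) (self_affine_iterated n) fi).
Qed.

(** The dependence on [x] separates from that on [b]; the first factor is a phase common to all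
    [b]. *)
Lemma character_iterated n b l x :
  character (zvec R l) (T n b x) =
  character ((A ^+ n)^T *m zvec R l) x * chi n b l.
Proof.
rewrite /T mulmxDr characterDr [character _ (A ^+ n *m zvec R b)]characterC.
by rewrite [X in X * _]characterC character_mulmxl [character x _]characterC.
Qed.

(** One formula for two uses: with [F b = f \o T n b] the integral is the Fourier coefficient of [f]
    at [l], and with [F b] constant it is a finite transform times a value of the Fourier transform
    of [mu]. *)
Definition synthesis n (F : 'cV[int]_d -> 'cV[R]_d -> R[i]) l x : R[i] :=
  ((digit_weight n)%:num%:C)%C *
    \sum_(b <- D n) F b x * character (zvec R l) (T n b x).

Lemma cmeasurable_synthesis n F l : (forall b, cmeasurable (F b)) ->
  cmeasurable (synthesis n F l).
Proof.
move=> mF; apply: cmeasurableM; first exact: cmeasurable_cst.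
apply: cmeasurable_sum => b; apply: cmeasurableM => //.
exact: (cmeasurable_comp (@continuous_iterated_map n b)
  (cmeasurable_character _)).
Qed.

(* For fixed [x] the common phase [character ((A ^+ n)^T *m l) x] drops out, so
   the upper frame bound applies pointwise with the weights [F b x]. *)
Lemma bessel_synthesis n J (a a' : R) F : 0 <= a' ->
  digit_frame M B n J a a' -> (forall b, cmeasurable (F b)) ->
  ((\sum_(l <- J) normc2 (cintegral mu (synthesis n F l)))%:E <=
   a'%:E * ((digit_weight n)%:num%:E * \sum_(b <- D n) sqnorm mu (F b)))%E.
Proof.
move=> a'0 hJ mF; rewrite -sumEFin.
apply: (@le_trans _ _ (\sum_(l <- J) sqnorm mu (synthesis n F l))%E).
  by apply: lee_sum => l _; apply/normc2_cintegral_le/cmeasurable_synthesis.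
rewrite /sqnorm -!ge0_integral_sum//; last 4 first.
- by move=> b; exact: measurable_normc2.
- by move=> b x _; rewrite lee_fin normc2_ge0.
- by move=> l; apply: measurable_normc2; exact: cmeasurable_synthesis.
- by move=> l x _; rewrite lee_fin normc2_ge0.
have mS : measurable_fun [set: borel R d]
    (fun x => (\sum_(b <- D n) (normc2 (F b x))%:E)%E).
  by apply: emeasurable_sum => b; exact: measurable_normc2.
have S0 (x : borel R d) : (0 <= \sum_(b <- D n) (normc2 (F b x))%:E)%E.
  by apply: sume_ge0 => b _; rewrite lee_fin normc2_ge0.
rewrite muleA -EFinM -ge0_integralZl//; last by rewrite lee_fin mulr_ge0.
apply: ge0_le_integral => //.
- by move=> x _; apply: sume_ge0 => b _; rewrite lee_fin normc2_ge0.
- apply: emeasurable_sum => l; apply: measurable_normc2; exact: cmeasurable_synthesis.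
- by apply: emeasurable_funM.
move=> x _; rewrite !sumEFin -EFinM lee_fin.
have /andP[_] := hJ (fun b => F b x).
set W := \sum_(b <- D n) normc2 (F b x); set S := \sum_(l <- J) _ => h.
have -> : \sum_(l <- J) normc2 (synthesis n F l x) = c n ^+ 2 * S.
  rewrite /S mulr_sumr; apply: eq_bigr => l _.
  rewrite /synthesis normc2M normc2C; congr (_ * _).
  rewrite -[RHS]mul1r -(normc2_character ((A ^+ n)^T *m zvec R l) x) -normc2M.
  rewrite mulr_sumr; congr normc2; apply: eq_bigr => b _.
  by rewrite character_iterated; ring.
have N0 : (N ^ n)%:R != 0 :> R by rewrite pnatr_eq0 expn_eq0 negb_and -lt0n B_gt0.
apply: le_trans (ler_wpM2l (sqr_ge0 _) h) _.
by rewrite le_eqVlt; apply/orP; left; apply/eqP; rewrite /=; field.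
Qed.

Lemma cintegral_character_iterated n f l : square_integrable mu f ->
  cintegral mu (fun x => f x * character (zvec R l) x) =
  cintegral mu (synthesis n (fun b => f \o T n b) l).
Proof.
move=> sf.
have ig : cintegrable mu (fun x => f x * character (zvec R l) x).
  apply/square_integrable_cintegrable/square_integrableM1 => //.
    exact: cmeasurable_character.
  by move=> x; exact: normc2_character.
have [iT ->] := cintegral_iterated n ig.
have [iS S] := cintegral_sum iT.
by rewrite -S -cintegralZ.
Qed.

Lemma upper_bound n J (a a' : R) f : 0 <= a' ->
  digit_frame M B n J a a' -> square_integrable mu f ->
  ((\sum_(l <- J) normc2 (cintegral mu
    (fun x => f x * character (zvec R l) x)))%:E <= a'%:E * sqnorm mu f)%E.
Proof.
move=> a'0 hJ sf; have [mf _] := (square_integrableP mu f).1 sf.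
rewrite (sqnorm_iterated n mf).
under eq_bigr do rewrite (cintegral_character_iterated n _ sf).
apply: bessel_synthesis a'0 hJ _ => b.
exact: (cmeasurable_comp (@continuous_iterated_map n b)).
Qed.

End SelfAffine.

(** * The lower frame bound, up to the oscillation of [f] *)

Section LowerBound.
Context {R : realType} {d : nat}.
Variables (M : 'M[int]_d) (B : {fset 'cV[int]_d}).
Variable mu : probability (borel R d) R.
Local Notation D := (iterated_digits M B).
Local Notation Z := (zmat R M).
Local Notation A := (invmx (zmat R M)).
Local Notation N := (#|` B|).
Local Notation T := (iterated_map M).
Local Notation chi n b l := (character (A ^+ n *m zvec R b) (zvec R l)).
Local Notation c n := ((N ^ n)%:R^-1 : R).
Hypothesis M_unit : Z \in unitmx.
Hypothesis B_simple : simple_digit_set M B.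
Hypothesis mu_MB : self_affine M B mu.

(** Mean-square error of replacing [f] by [w b] along the map [T n b]. The images of the maps may
    overlap, so the [w b] need not define a function on space; the error is therefore measured
    branch by branch. *)
Definition oscillation n (f : 'cV[R]_d -> R[i]) (w : 'cV[int]_d -> R[i]) : \bar R :=
  ((c n)%:E *
    \sum_(b <- D n) sqnorm mu (fun x => (f (T n b x) - w b)%R))%E.

(** Only the common phase depends on [x], and its integral is the Fourier transform of [mu] at
    [(A ^+ n)^T *m l]. *)
Lemma cintegral_synthesis_cst n (w : 'cV[int]_d -> R[i]) l :
  cintegral mu (synthesis M B n (fun b _ => w b) l) =
  (c n)%:C%C * (\sum_(b <- D n) w b * chi n b l) *
    fourier mu ((A ^+ n)^T *m zvec R l).
Proof.
rewrite /fourier -cintegralZ; last first.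
  exact/square_integrable_cintegrable/square_integrable_character.
congr cintegral; apply/funext => x; rewrite /synthesis -mulrA; congr (_ * _).
rewrite mulr_suml; apply: eq_bigr => b _.
by rewrite character_iterated -mulrA [X in _ * X]mulrC.
Qed.

Lemma square_integrable_iterated n f b : b \in D n ->
  square_integrable mu f -> square_integrable mu (f \o T n b).
Proof.
move=> bD /square_integrableP[mf foo]; apply/square_integrableP.
split; first exact: (cmeasurable_comp (@continuous_iterated_map _ _ _ n b) mf).
have mf2 := measurable_normc2 mf.
have abs (h : borel R d -> R[i]) x :
    (normc2 (h x))%:E = `|(normc2 (h x))%:E|%E.
  by rewrite gee0_abs// lee_fin normc2_ge0.
have ig : mu.-integrable setT (EFin \o (fun x : borel R d => normc2 (f x))).
  apply/integrableP; split => //; apply: le_lt_trans foo.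
  by rewrite /sqnorm le_eqVlt; apply/orP; left; apply/eqP; apply: eq_integral => x _; rewrite /= [RHS]abs.
have /integrableP[_] := integrable_pushforward_sum
  (measurable_iterated_map M n) (digit_weight_neq0 mu_MB n)
  (self_affine_iterated M_unit B_simple mu_MB n) bD ig.
apply: le_lt_trans.
by rewrite /sqnorm le_eqVlt; apply/orP; left; apply/eqP; apply: eq_integral => x _; rewrite /= [LHS](abs (f \o T n b)).
Qed.

(** Let [v] be the coefficients of [f] and [u] those of the constants [w b]. The sum of [|u - v|^2]
    is at most [a' * eta] by the Bessel bound, [delta * a * W] is at most the sum of [|u|^2], and
    the squared norm of [f] is at most [2 * W + 2 * eta]. The remaining factors 2 come from
    [normc2_le2]. *)
Lemma lower_bound n J (a a' delta : R) f w (eta : R) :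
  0 <= a -> 0 <= a' -> 0 <= delta ->
  digit_frame M B n J a a' -> square_integrable mu f ->
  (forall l, l \in J -> delta <= normc2 (fourier mu ((A ^+ n)^T *m zvec R l))) ->
  (oscillation n f w <= eta%:E)%E ->
  ((delta * a / 2)%:E * sqnorm mu f <=
   (2 * \sum_(l <- J) normc2 (cintegral mu
      (fun x => f x * character (zvec R l) x)) +
    (2 * a' + delta * a) * eta)%:E)%E.
Proof.
move=> a0 a'0 delta0 hJ sf hdelta osc.
have [mf foo] := (square_integrableP mu f).1 sf.
have N0 : 0 < (N ^ n)%:R :> R.
  by rewrite ltr0n expn_gt0 (B_gt0 mu_MB).
have c0 : 0 <= c n by rewrite invr_ge0 ler0n.
have mT b : cmeasurable (f \o T n b).
  exact: (cmeasurable_comp (@continuous_iterated_map _ _ _ n b) mf).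
pose Fw b x := f (T n b x) - w b.
pose v l := cintegral mu (fun x => f x * character (zvec R l) x).
pose u l := cintegral mu (synthesis M B n (fun b _ => w b) l).
pose W := c n * \sum_(b <- D n) normc2 (w b).
have mFw b : cmeasurable (Fw b).
  by apply: cmeasurableB; [exact: mT | exact: cmeasurable_cst].
have vE l : v l = cintegral mu (synthesis M B n Fw l) + u l.
  have mchar b : cmeasurable (character (zvec R l) \o T n b).
    exact: (cmeasurable_comp (@continuous_iterated_map _ _ _ n b)
      (cmeasurable_character _)).
  have chi1 b x : normc2 ((character (zvec R l) \o T n b) x) = 1.
    exact: normc2_character.
  have iw b : cintegrable mu (fun x => w b * character (zvec R l) (T n b x)).
    apply/cintegrableZ/square_integrable_cintegrable.
    (* [character 0] is the constant 1, so the product is the unimodular factor alone. *)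
    have := square_integrableM1 (square_integrable_character mu 0)
      (mchar b) (chi1 b).
    by under eq_fun do rewrite characterC character0r mul1r.
  have iF b : b \in D n ->
      cintegrable mu (fun x => Fw b x * character (zvec R l) (T n b x)).
    move=> bD; rewrite /Fw; under eq_fun do rewrite mulrBl -mulN1r.
    apply: cintegrableD; last exact: cintegrableZ.
    apply: square_integrable_cintegrable.
    exact: (square_integrableM1 (square_integrable_iterated bD sf)
      (mchar b) (chi1 b)).
  transitivity (cintegral mu (synthesis M B n (fun b => f \o T n b) l)).
    exact: (cintegral_character_iterated M_unit B_simple mu_MB).
  rewrite -cintegralD.
  - congr cintegral; apply/funext => x; rewrite /synthesis -mulrDr.
    congr (_ * _); rewrite -big_split; apply: eq_bigr => b _ /=.
    by rewrite /Fw mulrBl subrK.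
  - by apply: cintegrableZ; exact: (cintegral_sum iF).1.
  - apply: cintegrableZ.
    exact: (cintegral_sum (fun b (_ : b \in (D n : seq _)) => iw b)).1.
have uv : \sum_(l <- J) normc2 (u l - v l) <= a' * eta.
  rewrite -lee_fin EFinM.
  have a'osc : (a'%:E * oscillation n f w <= a'%:E * eta%:E)%E.
    by rewrite lee_wpmul2l// lee_fin.
  apply: le_trans a'osc.
  have := bessel_synthesis mu_MB a'0 hJ mFw.
  apply: le_trans; rewrite lee_fin; apply: ler_sum => l _.
  by rewrite vE opprD addrCA subrr addr0 normc2N.
have lo : delta * a * W <= \sum_(l <- J) normc2 (u l).
  have /andP[+ _] := hJ w; rewrite -/(W).
  set S := \sum_(l <- J) _ => h.
  have E : \sum_(l <- J) delta * (c n ^+ 2 *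
      normc2 (\sum_(b <- D n) w b * chi n b l)) <= \sum_(l <- J) normc2 (u l).
    rewrite !big_seq; apply: ler_sum => l lJ.
    rewrite /u cintegral_synthesis_cst !normc2M normc2C mulrC.
    by rewrite ler_wpM2l ?hdelta// mulr_ge0 ?sqr_ge0 ?normc2_ge0.
  apply: le_trans E; rewrite -mulr_sumr -mulr_sumr -/S -mulrA ler_wpM2l//.
  apply: le_trans (ler_wpM2l (sqr_ge0 (c n)) h).
  rewrite le_eqVlt; apply/orP; left; apply/eqP; rewrite /W.
  by field; rewrite gt_eqF.
have up : (sqnorm mu f <= (2 * W + 2 * eta)%:E)%E.
  have osc2 : (2%:E * oscillation n f w <= (2 * eta)%:E)%E.
    by rewrite EFinM lee_wpmul2l.
  rewrite (sqnorm_iterated M_unit B_simple mu_MB n mf) EFinD.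
  apply: le_trans (leeD2l _ osc2).
  rewrite /oscillation muleCA /W mulrCA [(_ * (2 * _))%:E]EFinM.
  rewrite -ge0_muleDr; last 2 first.
  - by rewrite lee_fin mulr_ge0// sumr_ge0// => b _; exact: normc2_ge0.
  - by rewrite mule_ge0// sume_ge0// => b _; exact: sqnorm_ge0.
  rewrite lee_wpmul2l ?lee_fin// EFinM -sumEFin.
  rewrite !ge0_sume_distrr; last 2 first.
  - by move=> b _; exact: sqnorm_ge0.
  - by move=> b _; rewrite lee_fin normc2_ge0.
  rewrite -big_split; apply: lee_sum => b _ /=.
  by have := sqnorm_le2 mu (mT b) (cmeasurable_cst (w b)); rewrite sqnorm_cst.
have S2 : \sum_(l <- J) normc2 (u l) <=
    2 * \sum_(l <- J) normc2 (v l) + 2 * \sum_(l <- J) normc2 (u l - v l).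
  rewrite !mulr_sumr -big_split; apply: ler_sum => l _; exact: normc2_le2.
have p0 : (0 <= (delta * a / 2)%:E)%E by rewrite lee_fin divr_ge0// mulr_ge0.
apply: le_trans (lee_wpmul2l p0 up) _.
rewrite -EFinM lee_fin.
apply: (@le_trans _ _ (delta * a * W + delta * a * eta)).
  by rewrite le_eqVlt; apply/orP; left; apply/eqP; field.
move: lo uv S2; lra.
Qed.

End LowerBound.

(** * Sets predicted by the digits: closure properties *)

Section CylinderApproximation.
Context {R : realType} {d : nat}.
Variables (M : 'M[int]_d) (B : {fset 'cV[int]_d}).
Variable mu : probability (borel R d) R.
Local Notation D := (iterated_digits M B).
Local Notation Z := (zmat R M).
Local Notation N := (#|` B|).
Local Notation T := (iterated_map M).
Local Notation c n := ((N ^ n)%:R^-1 : R).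
Hypothesis M_exp : expansive R M.
Hypothesis B_simple : simple_digit_set M B.
Hypothesis mu_MB : self_affine M B mu.
Let M_unit : Z \in unitmx := expansive_unit M_exp.

Let c0 n : (0 <= (c n)%:E :> \bar R)%E.
Proof. by rewrite lee_fin invr_ge0 ler0n. Qed.

Lemma measure_subU (E F G : set (borel R d)) :
  measurable E -> measurable F -> measurable G -> E `<=` F `|` G ->
  (mu E <= mu F + mu G)%E.
Proof.
move=> mE mF mG EFG; apply: (@le_trans _ _ (mu (F `|` G))).
  by apply: le_measure; rewrite ?inE//; exact: measurableU.
exact: measureU2.
Qed.

Lemma measurable_iterated_preimage n b (E : set (borel R d)) : measurable E ->
  measurable (T n b @^-1` E : set (borel R d)).
Proof.
by move=> mE; rewrite -[X in measurable X]setTI; exact: measurable_iterated_map.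
Qed.

(* [S b] predicts whether [T n b x] lies in [E]; the value is the measure of the
   set on which the prediction fails. *)
Definition set_oscillation n (E : set (borel R d)) (S : pred 'cV[int]_d) : \bar R :=
  ((c n)%:E * \sum_(b <- D n) mu (T n b @^-1` (if S b then ~` E else E)))%E.

(** Prediction is required at every large level: two sets must be handled at a common [n], and the
    levels of the frames are imposed later. *)
Definition set_approximable (E : set (borel R d)) : Prop :=
  measurable E /\ forall eps : R, 0 < eps ->
    \forall n \near \oo, exists S, (set_oscillation n E S <= eps%:E)%E.

Lemma set_oscillation_le n E S (s : 'cV[int]_d -> \bar R) :
  (forall b, b \in D n -> mu (T n b @^-1` (if S b then ~` E else E)) <= s b)%E ->
  (set_oscillation n E S <= (c n)%:E * \sum_(b <- D n) s b)%E.
Proof.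
move=> h; rewrite /set_oscillation lee_wpmul2l// !big_seq; exact: lee_sum.
Qed.

Lemma digit_average_cst n (x : \bar R) : (0 <= x)%E ->
  ((c n)%:E * \sum_(b <- D n) x = x)%E.
Proof.
move=> x0; rewrite big_const_seq count_predT.
rewrite (card_iterated_digits M_unit B_simple).
have N0 : (N ^ n)%:R != 0 :> R.
  by rewrite pnatr_eq0 expn_eq0 negb_and -lt0n (B_gt0 mu_MB).
have -> : iter (N ^ n) (fun y => x + y)%E 0%E = ((N ^ n)%:R%:E * x)%E.
  elim: (N ^ n)%N => [|k /= ->]; first by rewrite mul0e.
  rewrite -[k.+1%:R]natr1 EFinD ge0_muleDl ?lee_fin ?ler0n ?ler01//.
  by rewrite mul1e addeC.
by rewrite muleA -EFinM mulVf// mul1e.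
Qed.

Lemma set_approximableC E : set_approximable E -> set_approximable (~` E).
Proof.
move=> [mE hE]; split=> [|eps eps0]; first exact: measurableC.
apply: filterS (hE eps eps0) => n [S hS]; exists (predC S).
rewrite (_ : set_oscillation _ _ _ = set_oscillation n E S)//.
congr (_ * _)%E; apply: eq_bigr => b _ /=.
by case: (S b) => //=; rewrite setCK.
Qed.

Lemma set_approximable0 : set_approximable set0.
Proof.
split=> // eps eps0; near=> n; exists xpred0.
rewrite /set_oscillation big1 ?mule0 ?lee_fin ?ltW// => b _.
by rewrite preimage_set0 measure0.
Unshelve. all: by end_near.
Qed.

(** When the prediction [S b || S' b] fails for the union, [S] fails for [E] or [S'] fails for
    [F]. *)
Lemma set_approximableU E F :
  set_approximable E -> set_approximable F -> set_approximable (E `|` F).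
Proof.
move=> [mE hE] [mF hF]; split=> [|eps eps0]; first exact: measurableU.
have e2 : 0 < eps / 2 by rewrite divr_gt0.
near=> n.
have [S hS] : exists S, (set_oscillation n E S <= (eps / 2)%:E)%E.
  by near: n; exact: hE.
have [S' hS'] : exists S, (set_oscillation n F S <= (eps / 2)%:E)%E.
  by near: n; exact: hF.
exists (fun b => S b || S' b).
rewrite [eps]splitr EFinD; apply: le_trans (leeD hS hS').
rewrite /set_oscillation -ge0_muleDr; last 2 first.
- by apply: sume_ge0 => b _; exact: measure_ge0.
- by apply: sume_ge0 => b _; exact: measure_ge0.
rewrite -big_split; apply: set_oscillation_le => b _.
have mEF (s : bool) (G : set 'cV[R]_d) : measurable (G : set (borel R d)) ->
    measurable (T n b @^-1` (if s then ~` G else G) : set (borel R d)).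
  move=> mG; apply: measurable_iterated_preimage.
  by case: s => //; exact: measurableC.
apply: measure_subU => //=; [by apply: mEF; exact: measurableU| | |].
- exact: mEF.
- exact: mEF.
move=> x; case: (S b) => /=.
  by move=> nEF; left => Ex; apply: nEF; left.
case: (S' b) => //= nEF.
by right => Fx; apply: nEF; right.
Unshelve. all: by end_near.
Qed.

(** The predictor of [F] also serves [E]. It fails for [E] only where it fails for [F] or where
    [T n b x] lies in the difference, and the average measure of the latter event is [mu (E]\[F)] at
    every level. *)
Lemma set_approximable_lim (E : set (borel R d)) : measurable E ->
  (forall eps : R, 0 < eps -> exists F, [/\ set_approximable F, F `<=` E &
    (mu (E `\` F) <= eps%:E)%E]) ->
  set_approximable E.
Proof.
move=> mE h; split=> // eps eps0.
have e2 : 0 < eps / 2 by rewrite divr_gt0.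
have [F [[mF hF] FE muEF]] := h _ e2.
apply: filterS (hF _ e2) => n [S hS]; exists S.
have mEF : measurable (E `\` F) by exact: measurableD.
rewrite [eps]splitr EFinD; apply: le_trans (leeD hS muEF).
rewrite (self_affine_iterated M_unit B_simple mu_MB n mEF) /=.
rewrite /set_oscillation -ge0_muleDr; last 2 first.
- by apply: sume_ge0 => b _; exact: measure_ge0.
- by apply: sume_ge0 => b _; exact: measure_ge0.
rewrite -big_split; apply: set_oscillation_le => b _ /=.
have mT (G : set 'cV[R]_d) : measurable (G : set (borel R d)) ->
    measurable (T n b @^-1` G : set (borel R d)).
  exact: measurable_iterated_preimage.
case: (S b).
  rewrite (@le_trans _ _ (mu (T n b @^-1` ~` F)))//; last first.
    by rewrite leeDl// measure_ge0.
  apply: le_measure; rewrite ?inE;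
    [by apply: mT; exact: measurableC|by apply: mT; exact: measurableC|].
  by move=> x /=; apply: contra_not => /FE.
apply: measure_subU; [exact: mT|exact: mT|exact: mT|].
move=> x /= Ex; have [Fx|nFx] := pselect (F (T n b x)); first by left.
by right.
Qed.

Lemma measure_setD_cvg (F : (set (borel R d))^nat) (eps : R) : 0 < eps ->
  (forall k, measurable (F k)) -> nondecreasing_seq F ->
  \forall k \near \oo, (mu (\bigcup_i F i `\` F k) <= eps%:E)%E.
Proof.
move=> eps0 mF ndF.
have mU : measurable (\bigcup_i F i) by exact: bigcup_measurable.
have mD k : measurable (\bigcup_i F i `\` F k) by exact: measurableD.
have I0 : \bigcap_k (\bigcup_i F i `\` F k) = set0.
  apply/seteqP; split => // x h; have [[i _ Fx] _] := h 0%N I.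
  by have [_] := h i I.
have : (fun k => mu (\bigcup_i F i `\` F k)) @ \oo --> 0%E.
  rewrite -(measure0 mu) -I0; apply: nonincreasing_cvg_mu => //.
  - by rewrite (le_lt_trans (probability_le1 _ _)) ?ltry.
  - by rewrite I0.
  - move=> k l kl; apply/subsetPset; apply: setDS.
    by apply/subsetPset; exact: ndF.
move=> /fine_cvgP[_ /cvgrPdist_lt/(_ _ eps0)]; apply: filterS => k /=.
rewrite sub0r normrN => /ltW h.
have fk : mu (\bigcup_i F i `\` F k) \is a fin_num by exact: fin_num_measure.
by rewrite -(fineK fk) lee_fin (le_trans (ler_norm _)).
Qed.

(** Finite unions exhaust the union in measure. *)
Lemma set_approximable_bigcup (F : (set (borel R d))^nat) :
  (forall k, set_approximable (F k)) -> set_approximable (\bigcup_k F k).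
Proof.
move=> hF; pose G n := \bigcup_(k < n) F k.
have hG n : set_approximable (G n).
  rewrite /G; elim: n => [|n ih]; first by rewrite II0 bigcup_set0; exact: set_approximable0.
  by rewrite bigcup_mkord big_ord_recr /= -bigcup_mkord; exact: set_approximableU.
have GF : \bigcup_k F k = \bigcup_n G n.
  apply/seteqP; split=> [x [k _ Fx]|x [n _ [k _ Fx]]]; last by exists k.
  by exists k.+1 => //; exists k => /=.
have mG n : measurable (G n) by have [] := hG n.
apply: set_approximable_lim => [|eps eps0].
  by apply: bigcup_measurable => k _; have [] := hF k.
have ndG : nondecreasing_seq G.
  move=> m n mn; apply/subsetPset => x [k /= km Fx].
  by exists k => //=; exact: leq_trans mn.
have [k _ /(_ k (leqnn k)) hk] := measure_setD_cvg eps0 mG ndG.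
exists (G k); split; [exact: hG | by move=> x [i _ Fx]; exists i |].
by rewrite GF.
Qed.

End CylinderApproximation.

(** * Open sets, and hence all Borel sets, are predicted by the digits *)

Section OpenApproximation.
Context {R : realType} {d : nat}.
Variables (M : 'M[int]_d) (B : {fset 'cV[int]_d}).
Variable mu : probability (borel R d) R.
Local Notation Z := (zmat R M).
Local Notation A := (invmx (zmat R M)).
Local Notation T := (iterated_map M).
Hypothesis M_exp : expansive R M.
Hypothesis B_simple : simple_digit_set M B.
Hypothesis mu_MB : self_affine M B mu.
Let M_unit : Z \in unitmx := expansive_unit M_exp.

(** [T n 0 x] is [A ^+ n *m x], the part of [T n b x] that does not depend on [b]; here it is not
    small. *)
Definition escape n (rho : R) : set 'cV[R]_d := T n 0 @^-1` (~` ball (0 : 'cV[R]_d) rho).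

Lemma open_cV_ball (x : 'cV[R]_d) (rho : R) : open (ball x rho).
Proof.
have [rho0|rho0] := ltP 0 rho; first exact: ball_open.
suff -> : ball x rho = set0 by exact: open0.
by apply/seteqP; split => // y []; rewrite ltNge rho0.
Qed.

Lemma measurable_escape n rho : measurable (escape n rho : set (borel R d)).
Proof.
apply: measurable_iterated_preimage; apply: measurableC.
apply: borel_measurable_open; exact: open_cV_ball.
Qed.

Lemma escapeE n rho x : 0 < rho -> ~ escape n rho x -> `|A ^+ n *m x| < rho.
Proof.
by move=> rho0 /contrapT; rewrite /iterated_map zvec0 addr0 -ball_normE /= sub0r normrN.
Qed.

(** Every point ends up in the ball for good, so the sets [P k] of points that stay in it from step
    [k] on increase to the whole space. *)
Lemma measure_escape_near rho eps : 0 < rho -> 0 < eps ->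
  \forall n \near \oo, (mu (escape n rho) <= eps%:E)%E.
Proof.
move=> rho0 eps0; pose P k : set (borel R d) := \bigcap_(n >= k) ~` escape n rho.
have mP k : measurable (P k).
  apply: bigcap_measurable => [|n _]; first by exists k => /=.
  by apply: measurableC; exact: measurable_escape.
have ndP : nondecreasing_seq P.
  move=> k l kl; apply/subsetPset => x h n /= ln; apply: h.
  exact: leq_trans kl ln.
have PT : \bigcup_k P k = setT.
  apply/seteqP; split => // x _.
  have [k _ hk] := expansive_mulmx_lt x M_exp rho0.
  exists k => // n kn; have [+ _] := hk n kn.
  move=> h; rewrite /escape /= /iterated_map zvec0 addr0 -ball_normE /=.
  by rewrite sub0r normrN => /(_ h).
apply: filterS (measure_setD_cvg mu eps0 mP ndP) => n; apply: le_trans.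
apply: le_measure; rewrite ?inE.
- exact: measurable_escape.
- by rewrite PT; exact: measurableD.
by rewrite PT => x ex; split => // h; exact: (h n (leqnn n) ex).
Qed.

(** [T n b x] differs from [A ^+ n *m b] by [A ^+ n *m x]. Hence [b] decides membership in [U]
    unless [x] escapes or [T n b x] lies in [U] but close to its complement, that is outside [V j];
    both events have small measure. *)
Lemma set_approximable_open (U : set 'cV[R]_d) : open U ->
  set_approximable M B mu U.
Proof.
move=> oU; split=> [|eps eps0]; first exact: borel_measurable_open.
have e2 : 0 < eps / 2 by rewrite divr_gt0.
pose V j : set (borel R d) := [set x | ball (x : 'cV[R]_d) j.+1%:R^-1 `<=` U].
have mV j : measurable (V j).
  rewrite -[V j]setCK; apply: measurableC; apply: borel_measurable_open.
  rewrite (_ : ~` _ = \bigcup_(y in ~` U) ball (y : 'cV[R]_d) (j.+1%:R^-1 : R)).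
    by apply: bigcup_open => y _; exact: open_cV_ball.
  apply/seteqP; split => [x /= /existsNP[y /not_implyP[xy nUy]]|x [y nUy yx] h].
    by exists y => //; exact: ball_sym.
  by apply: nUy; apply: h; exact: ball_sym.
have ndV : nondecreasing_seq V.
  move=> k l kl; apply/subsetPset => x; apply: subset_trans; apply: le_ball.
  by rewrite lef_pV2 ?posrE// ler_nat.
have VU : \bigcup_j V j = U.
  apply/seteqP; split=> [x [j _]|x Ux].
    by apply; apply: ballxx.
  have /nbhs_ballP[e e0 he] : nbhs x U by exact: open_nbhs_nbhs.
  have [j hj] : exists j : nat, j.+1%:R^-1 <= e :> R.
    exists (Num.trunc e^-1); rewrite invf_ple ?posrE//.
    by apply: ltW; exact: truncnS_gt.
  by exists j => //; apply: subset_trans he; exact: le_ball.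
have [j _ /(_ j (leqnn j)) hj] := measure_setD_cvg mu e2 mV ndV.
rewrite VU in hj; set rho : R := j.+1%:R^-1 in hj.
have rho0 : 0 < rho / 2 by rewrite divr_gt0// invr_gt0.
apply: filterS (measure_escape_near rho0 e2) => n hn.
(* Half of [rho]: if [T n b x] is within [rho / 2] of the centre, its ball of radius [rho] contains
   this one, so a negative prediction rules out [V j]. *)
exists (fun b => `[< ball (A ^+ n *m zvec R b) (rho / 2) `<=` U >]).
have mUV : measurable (U `\` V j : set (borel R d)).
  by apply: measurableD => //; exact: borel_measurable_open.
rewrite [eps]splitr EFinD; apply: le_trans (leeD hn hj).
rewrite (self_affine_iterated M_unit B_simple mu_MB n mUV) /=.
(* The escape set does not depend on [b]; its measure is written as an average so that the two
   errors can be compared term by term. *)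
rewrite -[X in (X + _)%E](digit_average_cst M_exp B_simple mu_MB n); last exact: measure_ge0.
rewrite -ge0_muleDr; last 2 first.
- by apply: sume_ge0 => b _; exact: measure_ge0.
- by apply: sume_ge0 => b _; exact: measure_ge0.
rewrite -big_split; apply: set_oscillation_le => b _ /=.
have mU : measurable (U : set (borel R d)) by exact: borel_measurable_open.
apply: measure_subU.
- by apply: measurable_iterated_preimage; case: asboolP => // _; exact: measurableC.
- exact: measurable_escape.
- exact: measurable_iterated_preimage.
move=> x; have [|/(escapeE rho0) small] := pselect (escape n (rho / 2) x); first by left.
have TE : T n b x = A ^+ n *m x + A ^+ n *m zvec R b by rewrite /iterated_map mulmxDr.
case: asboolP => /= [bU nU|nbU UT].
  exfalso; apply: nU; apply: bU; rewrite TE -ball_normE /=.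
  by rewrite opprD addrCA subrr addr0 normrN.
right; split => // VT; apply: nbU => y; rewrite -ball_normE /= => hy.
apply: VT; rewrite -ball_normE /= TE.
rewrite -addrA; apply: (@lt_le_trans _ _ (rho / 2 + rho / 2)).
  by rewrite (le_lt_trans (ler_normD _ _))// ltrD.
by rewrite -splitr.
Qed.

Lemma set_approximable_measurable (E : set (borel R d)) : measurable E ->
  set_approximable M B mu E.
Proof.
move: E; apply: smallest_sub; last exact: set_approximable_open.
split.
- exact: set_approximable0.
- by move=> E hE; rewrite setTD; exact: set_approximableC.
- by move=> F hF; apply: set_approximable_bigcup.
Qed.

End OpenApproximation.

(** * Functions nearly constant along each branch: closure properties *)

Section FunctionApproximation.
Context {R : realType} {d : nat}.
Variables (M : 'M[int]_d) (B : {fset 'cV[int]_d}).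
Variable mu : probability (borel R d) R.
Local Notation D := (iterated_digits M B).
Local Notation Z := (zmat R M).
Local Notation N := (#|` B|).
Local Notation T := (iterated_map M).
Local Notation c n := ((N ^ n)%:R^-1 : R).
Hypothesis M_exp : expansive R M.
Hypothesis B_simple : simple_digit_set M B.
Hypothesis mu_MB : self_affine M B mu.
Let M_unit : Z \in unitmx := expansive_unit M_exp.
Implicit Types f g : 'cV[R]_d -> R[i].

Let c0 n : (0 <= (c n)%:E :> \bar R)%E.
Proof. by rewrite lee_fin invr_ge0 ler0n. Qed.

Definition approximable f : Prop := cmeasurable f /\
  forall eps : R, 0 < eps ->
    \forall n \near \oo, exists w, (oscillation M B mu n f w <= eps%:E)%E.

Lemma cmeasurable_iterated n b f :
  cmeasurable f -> cmeasurable (fun x => f (T n b x)).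
Proof. exact: (cmeasurable_comp (@continuous_iterated_map _ _ M n b)). Qed.

(** Shared by limits and sums: in both, passing from [f] to [g] changes the branch errors by a
    remainder whose average is known to be small. *)
Lemma oscillation_le2 n f g w w' (rem : 'cV[int]_d -> \bar R) :
  cmeasurable f -> cmeasurable g -> (forall b, 0 <= rem b)%E ->
  (forall b, sqnorm mu (fun x => (f (T n b x) - w b - (g (T n b x) - w' b))%R) <= rem b)%E ->
  (oscillation M B mu n f w <= 2%:E * oscillation M B mu n g w' +
    2%:E * ((c n)%:E * \sum_(b <- D n) rem b))%E.
Proof.
move=> mf mg rem0 hrem; rewrite /oscillation !(muleCA 2%:E).
rewrite -ge0_muleDr; last 2 first.
- by rewrite mule_ge0// sume_ge0// => b _; exact: sqnorm_ge0.
- by rewrite mule_ge0// sume_ge0// => b _; exact: sqnorm_ge0.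
rewrite lee_wpmul2l// !ge0_sume_distrr; last 2 first.
- by move=> b _.
- by move=> b _; exact: sqnorm_ge0.
rewrite -big_split; apply: lee_sum => b _ /=.
have m (h : 'cV[R]_d -> R[i]) v : cmeasurable h -> cmeasurable (fun x => h (T n b x) - v b).
  move=> mh; apply: cmeasurableB; last exact: cmeasurable_cst.
  exact: cmeasurable_iterated.
apply: le_trans (sqnorm_le2 mu (m _ w mf) (m _ w' mg)) _.
by apply: leeD => //; rewrite lee_wpmul2l// lee_fin.
Qed.

(** The constants found for [g] also serve [f]: by self-affinity the average over [b] of the squared
    norm of [f - g] along [T n b] is its squared norm, uniformly in [n]. *)
Lemma approximable_lim f : cmeasurable f ->
  (forall eps : R, 0 < eps -> exists g, approximable g /\
    (sqnorm mu (fun x => (f x - g x)%R) <= eps%:E)%E) ->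
  approximable f.
Proof.
move=> mf h; split=> // eps eps0.
have e4 : 0 < eps / 4 by rewrite divr_gt0.
have [g [[mg hg] fg]] := h _ e4.
apply: filterS (hg _ e4) => n [w hw]; exists w.
have mfg : cmeasurable (fun x => f x - g x) by exact: cmeasurableB.
apply: le_trans (@oscillation_le2 n f g w w
  (fun b => sqnorm mu ((fun x => (f x - g x)%R) \o T n b)) mf mg _ _) _.
- by move=> b; exact: sqnorm_ge0.
- move=> b; apply: le_sqnorm.
  + apply: cmeasurableB; apply: cmeasurableB;
      by [exact: cmeasurable_iterated|exact: cmeasurable_cst].
  + exact: cmeasurable_iterated.
  + by move=> x /=; rewrite (_ : _ - _ - _ = f (T n b x) - g (T n b x))//; ring.
have := sqnorm_iterated M_unit B_simple mu_MB n mfg; rewrite /= => <-.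
have -> : eps%:E = (2%:E * (eps / 4)%:E + 2%:E * (eps / 4)%:E)%E.
  by rewrite -!EFinM -EFinD; congr EFin; field.
by apply: leeD; rewrite lee_wpmul2l// lee_fin.
Qed.

Lemma approximableZ (k : R[i]) f : approximable f -> approximable (fun x => k * f x).
Proof.
move=> [mf hf]; split=> [|eps eps0].
  by apply: cmeasurableM => //; exact: cmeasurable_cst.
(* The summand 1 keeps the divisor positive when [k] is 0. *)
have k0 : 0 < 1 + normc2 k by rewrite ltr_pwDl// normc2_ge0.
have e0 : 0 < eps / (1 + normc2 k) by rewrite divr_gt0.
apply: filterS (hf _ e0) => n [w hw]; exists (fun b => k * w b).
apply: (@le_trans _ _ ((1 + normc2 k)%:E * oscillation M B mu n f w)%E); last first.
  apply: (@le_trans _ _ ((1 + normc2 k)%:E * (eps / (1 + normc2 k))%:E)%E).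
    by rewrite lee_wpmul2l// lee_fin ltW.
  by rewrite -EFinM lee_fin mulrC divfK// gt_eqF.
rewrite /oscillation muleCA lee_wpmul2l// ge0_sume_distrr => [|b _]; last exact: sqnorm_ge0.
apply: lee_sum => b _.
have mfw : cmeasurable (fun x => f (T n b x) - w b).
  by apply: cmeasurableB; [exact: cmeasurable_iterated|exact: cmeasurable_cst].
rewrite /sqnorm -ge0_integralZl//; last 3 first.
- exact: measurable_normc2.
- by move=> x _; rewrite lee_fin normc2_ge0.
- by rewrite lee_fin ltW.
apply: ge0_le_integral => //.
- by move=> x _; rewrite lee_fin normc2_ge0.
- apply: measurable_normc2; apply: cmeasurableB; last exact: cmeasurable_cst.
  apply: cmeasurableM; [exact: cmeasurable_cst|exact: cmeasurable_iterated].
- by apply: emeasurable_funM => //; exact: measurable_normc2.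
- move=> x _; rewrite -EFinM lee_fin -mulrBr normc2M ler_wpM2r ?normc2_ge0//.
  by rewrite lerDr.
Qed.

Lemma approximable_cst (k : R[i]) : approximable (fun=> k).
Proof.
split=> [|eps eps0]; first exact: cmeasurable_cst.
near=> n; exists (fun=> k); rewrite /oscillation big1 ?mule0 ?lee_fin ?ltW// => b _.
by rewrite subrr sqnorm_cst normc2_0.
Unshelve. all: by end_near.
Qed.

Lemma approximableD f g : approximable f -> approximable g ->
  approximable (fun x => f x + g x).
Proof.
move=> [mf hf] [mg hg]; split=> [|eps eps0]; first exact: cmeasurableD.
have e4 : 0 < eps / 4 by rewrite divr_gt0.
near=> n.
have [w hw] : exists w, (oscillation M B mu n f w <= (eps / 4)%:E)%E.
  by near: n; exact: hf.
have [w' hw'] : exists w, (oscillation M B mu n g w <= (eps / 4)%:E)%E.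
  by near: n; exact: hg.
exists (fun b => w b + w' b).
apply: le_trans (@oscillation_le2 n _ f _ w
  (fun b => sqnorm mu (fun x => (g (T n b x) - w' b)%R)) (cmeasurableD mf mg) mf _ _) _.
- by move=> b; exact: sqnorm_ge0.
- move=> b; apply: le_sqnorm.
  + apply: cmeasurableB; apply: cmeasurableB; try exact: cmeasurable_cst;
      last exact: cmeasurable_iterated.
    by apply: cmeasurableD; exact: cmeasurable_iterated.
  + by apply: cmeasurableB; [exact: cmeasurable_iterated|exact: cmeasurable_cst].
  + by move=> x /=; rewrite (_ : _ - _ - _ = g (T n b x) - w' b)//; ring.
have -> : eps%:E = (2%:E * (eps / 4)%:E + 2%:E * (eps / 4)%:E)%E.
  by rewrite -!EFinM -EFinD; congr EFin; field.
by apply: leeD; rewrite lee_wpmul2l// lee_fin.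
Unshelve. all: by end_near.
Qed.

Lemma approximable_sum (I : Type) (s : seq I) (F : I -> 'cV[R]_d -> R[i]) :
  (forall i, approximable (F i)) -> approximable (fun x => \sum_(i <- s) F i x).
Proof.
move=> hF; elim: s => [|i s ih].
  by under eq_fun do rewrite big_nil; exact: approximable_cst.
by under eq_fun do rewrite big_cons; exact: approximableD.
Qed.

(** With the prediction as a weight 0 or 1, the squared error is the indicator of a failed
    prediction, so the two oscillations coincide. *)
Lemma approximable_indic (E : set (borel R d)) : measurable E ->
  approximable (fun x => (\1_E x)%:C%C).
Proof.
move=> mE; have [_ hE] := set_approximable_measurable M_exp B_simple mu_MB mE.
split=> [|eps eps0].
  by split => /=; [exact: measurable_indic | exact: measurable_cst].
apply: filterS (hE _ eps0) => n [S hS]; exists (fun b => (S b)%:R).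
apply: le_trans hS; rewrite /oscillation /set_oscillation.
rewrite lee_wpmul2l//; apply: lee_sum => b _.
have mTS : measurable (T n b @^-1` (if S b then ~` E else E) : set (borel R d)).
  apply: measurable_iterated_preimage; case: (S b) => //; exact: measurableC.
rewrite -[X in (_ <= mu X)%E]setIT -integral_indic// /sqnorm.
rewrite le_eqVlt; apply/orP; left; apply/eqP; apply: eq_integral => x _.
congr EFin; rewrite normc2E /= !indicE /=.
have [Ex|nEx] := pselect (E (T n b x)).
  rewrite (mem_set Ex); case: (S b) => /=.
    by rewrite memNset => [|/(_ Ex)//]; rewrite ?mulr0n ?mulr1n; ring.
  by rewrite mem_set// ?mulr0n ?mulr1n; ring.
rewrite (memNset nEx); case: (S b) => /=.
  by rewrite mem_set// ?mulr0n ?mulr1n; ring.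
by rewrite memNset// ?mulr0n ?mulr1n; ring.
Qed.

End FunctionApproximation.

(** * From indicators to square-integrable functions *)

Section SquareIntegrableApproximation.
Context {R : realType} {d : nat}.
Variables (M : 'M[int]_d) (B : {fset 'cV[int]_d}).
Variable mu : probability (borel R d) R.
Hypothesis M_exp : expansive R M.
Hypothesis B_simple : simple_digit_set M B.
Hypothesis mu_MB : self_affine M B mu.
Import HBNNSimple.
Local Notation approx := (approximable M B mu).

Lemma approximable_nnsfun (h : {nnsfun borel R d >-> R}) :
  approx (fun x => (h x)%:C%C).
Proof.
pose s := fset_set (h @` setT).
rewrite (_ : (fun x => _) = fun x => \sum_(i < #|` s|)
    ((s`_i)%:C%C * (\1_(h @^-1` [set s`_i]) x)%:C%C : R[i])); last first.
  apply/funext => x; rewrite [in LHS]fimfunEord rmorph_sum.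
  by apply: eq_bigr => i _; rewrite rmorphM.
apply: approximable_sum => // i; apply: approximableZ => //.
apply: approximable_indic => //.
Qed.

(** Simple functions increase to [g]; their squared errors are dominated by [g ^ 2], so the
    convergence also holds in mean square. *)
Lemma approximable_ge0 (g : borel R d -> R) : measurable_fun setT g ->
  (forall x, 0 <= g x) -> (\int[mu]_x (g x ^+ 2)%:E < +oo)%E ->
  approx (fun x => (g x)%:C%C).
Proof.
move=> mg g0 g2.
have cg : cmeasurable (fun x => (g x)%:C%C : R[i]).
  by split => //=; exact: measurable_cst.
have mgE : measurable_fun setT (EFin \o g) by exact/measurable_EFinP.
pose a := nnsfun_approx measurableT mgE.
have g0E x : setT x -> (0 <= (EFin \o g) x)%E by move=> _; rewrite lee_fin.
have acvg x : (fun n => (a n x)%:E) @ \oo --> (g x)%:E.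
  exact: (cvg_nnsfun_approx measurableT mgE g0E).
have acvgR x : (fun n => a n x) @ \oo --> g x.
  by have /fine_cvgP[_] := acvg x.
have ale n x : a n x <= g x.
  rewrite -(cvg_lim _ (acvgR x))//; apply: nondecreasing_cvgn_le.
    by move=> k l kl; have /lefP := nd_nnsfun_approx measurableT mgE kl; exact.
  by apply/cvg_ex; exists (g x); exact: acvgR.
have ma n : measurable_fun setT (a n) by [].
apply: approximable_lim => // eps eps0.
pose F n x := ((g x - a n x) ^+ 2)%:E.
have mF n : measurable_fun [set: borel R d] (F n).
  by apply/measurable_EFinP/measurable_funX/measurable_funB.
have ig : mu.-integrable setT (fun x => (g x ^+ 2)%:E).
  apply/integrableP; split; first exact/measurable_EFinP/measurable_funX.
  rewrite (eq_integral (fun x => (g x ^+ 2)%:E))// => x _.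
  by rewrite gee0_abs// lee_fin sqr_ge0.
have F0 : (fun n => \int[mu]_x F n x)%E @ \oo --> 0%E.
  rewrite -(integral0 mu [set: borel R d]).
  have F_cvg : {ae mu, forall x, setT x -> F ^~ x @ \oo --> 0%E}.
    apply: aeW => x _; apply/fine_cvgP; split; first exact: nearW.
    rewrite /F /= -[X in _ --> X](expr0n R 2) -(subrr (g x)).
    apply: (@cvg_comp _ _ _ (fun n => g x - a n x) (fun y => y ^+ 2) _ (nbhs (g x - g x))).
      by apply: cvgB; [exact: cvg_cst|exact: acvgR].
    exact: exprn_continuous.
  have F_le : {ae mu, forall x n, setT x -> (`|F n x| <= (g x ^+ 2)%:E)%E}.
    apply: aeW => x n _; rewrite /F gee0_abs ?lee_fin ?sqr_ge0//.
    by rewrite lerXn2r ?nnegrE ?subr_ge0 ?ale// gerDl oppr_le0.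
  by have [] := dominated_convergence measurableT mF (measurable_cst _) F_cvg ig F_le.
have [n hn] : exists n, (\int[mu]_x F n x <= eps%:E)%E.
  move/fine_cvgP : F0 => [[K _ hK] /cvgrPdist_lt/(_ _ eps0)[L _ hL]].
  exists (maxn K L); have := hL _ (leq_maxr K L); rewrite /= sub0r normrN.
  move=> /ltW h; rewrite -(fineK (hK _ (leq_maxl K L))) lee_fin.
  exact: le_trans (ler_norm _) h.
exists (fun x => (a n x)%:C%C); split; first exact: approximable_nnsfun.
apply: le_trans hn; rewrite /sqnorm le_eqVlt; apply/orP; left; apply/eqP.
apply: eq_integral => x _; congr EFin.
by rewrite -rmorphB normc2C.
Qed.

Lemma approximable_real (g : borel R d -> R) : measurable_fun setT g ->
  (\int[mu]_x (g x ^+ 2)%:E < +oo)%E -> approx (fun x => (g x)%:C%C).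
Proof.
move=> mg g2.
have mgn : measurable_fun setT (fun x => `|g x|) by exact: measurableT_comp.
have part (h : borel R d -> R) : measurable_fun setT h -> (forall x, 0 <= h x) ->
    (forall x, h x <= `|g x|) -> approx (fun x => (h x)%:C%C).
  move=> mh h0 hg; apply: approximable_ge0 => //; apply: le_lt_trans g2.
  apply: ge0_le_integral => //.
  - by move=> x _; rewrite lee_fin sqr_ge0.
  - exact/measurable_EFinP/measurable_funX.
  - exact/measurable_EFinP/measurable_funX.
  - by move=> x _; rewrite lee_fin -(real_normK (num_real (g x))) lerXn2r ?nnegrE.
have ap : approx (fun x => ((`|g x| + g x) / 2)%:C%C).
  apply: (part (fun x => (`|g x| + g x) / 2)) => [|x|x].
  - by apply: measurable_funM => //; exact: measurable_funD.
  - by rewrite divr_ge0//; have := ler_norm (- g x); rewrite normrN; lra.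
  - by have := ler_norm (g x); lra.
have am : approx (fun x => ((`|g x| - g x) / 2)%:C%C).
  apply: (part (fun x => (`|g x| - g x) / 2)) => [|x|x].
  - by apply: measurable_funM => //; exact: measurable_funB.
  - by rewrite divr_ge0// subr_ge0 ler_norm.
  - by have := ler_norm (- g x); rewrite normrN; lra.
rewrite (_ : (fun x => _) = fun x => ((`|g x| + g x) / 2)%:C%C +
    - 1 * ((`|g x| - g x) / 2)%:C%C :> R[i]); last first.
  by apply/funext => x; apply: complexP; rewrite /=; field.
by apply: approximableD => //; exact: approximableZ.
Qed.

Lemma approximable_square_integrable f : square_integrable mu f -> approx f.
Proof.
move=> [fr fi foo].
have sq_le (h : borel R d -> R) : measurable_fun setT h ->
    (forall x, h x ^+ 2 <= normc2 (f x)) -> approx (fun x => (h x)%:C%C).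
  move=> mh hf; apply: approximable_real => //; apply: le_lt_trans foo.
  apply: ge0_le_integral => //.
  - by move=> x _; rewrite lee_fin sqr_ge0.
  - exact/measurable_EFinP/measurable_funX.
  - exact: measurable_normc2.
  - by move=> x _; rewrite lee_fin hf.
rewrite (_ : f = fun x => (complex.Re (f x))%:C%C + 'i%C * (complex.Im (f x))%:C%C).
  apply: approximableD => //; last apply: approximableZ => //.
    by apply: sq_le => // x; rewrite normc2E lerDl sqr_ge0.
  by apply: sq_le => // x; rewrite normc2E lerDr sqr_ge0.
by apply/funext => x; rewrite -complexE.
Qed.

End SquareIntegrableApproximation.

(** * Uniform continuity of the Fourier transform *)

Section FourierTransform.
Context {R : realType} {d : nat}.
Variable mu : probability (borel R d) R.

(** The norm is the maximum norm, whence the factor [d]. *)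
Lemma normr_dot_le (x y : 'cV[R]_d) : `|dot x y| <= d%:R * `|x| * `|y|.
Proof.
have coord (v : 'cV[R]_d) i : `|v i ord0| <= `|v|.
  by rewrite [leRHS]mx_normrE; apply/bigmax_geP; right => /=; exists (i, ord0).
apply: le_trans (ler_norm_sum _ _ _) _.
apply: (@le_trans _ _ (\sum_(i < d) `|x| * `|y|)).
  by apply: ler_sum => i _; rewrite normrM ler_pM.
by rewrite sumr_const card_ord -mulrA mulr_natl.
Qed.

Lemma normc2_character_sub1 (y x : 'cV[R]_d) :
  normc2 (character y x - 1) = 2 * (1 - cos (2 * pi * dot y x)).
Proof.
rewrite normc2E /= cosN subr0.
have := cos2Dsin2 (- (2 * pi * dot y x)); rewrite cosN; nra.
Qed.

Lemma fourier0 : fourier mu 0 = 1.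
Proof.
have E : character (0 : 'cV[R]_d) = fun=> 1.
  by apply/funext => x; rewrite characterC character0r.
rewrite /fourier E; apply: complexP => /=; last by rewrite /Rintegral integral0.
have : (\int[mu]_x cst 1%:E x = 1%:E)%E.
  by rewrite integral_cst//= probability_setT mule1.
by rewrite /Rintegral /= => ->.
Qed.

(** The squared difference is at most the integral of [|character y - 1|^2], in which [xi] no longer
    occurs. The integrand is at most [e / 2] on a large ball if [y] is small, and at most 4 on the
    complement, of mass at most [e / 8]. *)
Lemma fourier_uniform (e : R) : 0 < e -> exists2 rho : R, 0 < rho &
  forall y : 'cV[R]_d, `|y| < rho ->
  forall xi, normc2 (fourier mu (xi + y) - fourier mu xi) <= e.
Proof.
move=> e0.
pose G k : set (borel R d) := [set x : 'cV[R]_d | `|x| < k%:R].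
have mG k : measurable (G k).
  apply: borel_measurable_open.
  rewrite (_ : G k = ball (0 : 'cV[R]_d) k%:R); first exact: open_cV_ball.
  by apply/seteqP; split => x; rewrite -ball_normE /G /= sub0r normrN.
have ndG : nondecreasing_seq G.
  move=> k l kl; apply/subsetPset => x /= xk.
  by rewrite /G /= (lt_le_trans xk)// ler_nat.
have GT : \bigcup_k G k = setT.
  apply/seteqP; split => // x _; exists (Num.trunc `|x : 'cV[R]_d|).+1 => //=.
  exact: truncnS_gt.
have e8 : 0 < e / 8 by rewrite divr_gt0.
have [k _ /(_ k (leqnn k)) hk] := measure_setD_cvg mu e8 mG ndG.
rewrite GT setTD in hk.
have e4 : 0 < e / 4 by rewrite divr_gt0.
have /cvgrPdist_lt/(_ _ e4)/nbhs_ballP[eta /= eta0 heta] := @continuous_cos R 0.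
have q0 : 0 < 2 * pi * (d%:R + 1) * (k%:R + 1) :> R.
  by rewrite !mulr_gt0// ?pi_gt0// ltr_pwDr// ler0n.
(* Makes [|2 * pi * dot y x| < eta] for [|x| < k]; the added ones keep the divisor positive when [d]
   or [k] is 0. *)
exists (eta / (2 * pi * (d%:R + 1) * (k%:R + 1))); first by rewrite divr_gt0.
move=> y; rewrite ltr_pdivlMr// => hy xi.
have mchi : cmeasurable (fun x => character y x - 1 : R[i]).
  by apply: cmeasurableB; [exact: cmeasurable_character|exact: cmeasurable_cst].
have E : fourier mu (xi + y) - fourier mu xi =
    cintegral mu (fun x => character xi x * (character y x - 1)).
  have ixi := square_integrable_cintegrable (square_integrable_character mu xi).
  have ixy := square_integrable_cintegrable (square_integrable_character mu (xi + y)).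
  rewrite /fourier -[X in _ - X]mul1r -mulNr -cintegralZ// -cintegralD//; last exact: cintegrableZ.
  by congr cintegral; apply/funext => x; rewrite characterDl; ring.
rewrite E -lee_fin; apply: le_trans (normc2_cintegral_le mu _) _.
  by apply: cmeasurableM => //; exact: cmeasurable_character.
have bound : (sqnorm mu (fun x => (character xi x * (character y x - 1))%R) <=
    \int[mu]_x ((e / 2)%:E + 4%:E * (\1_(~` G k) x)%:E))%E.
  have mi : measurable_fun [set: borel R d] (fun x => (4%:E * (\1_(~` G k) x)%:E)%E : \bar R).
    apply: emeasurable_funM => //; apply/measurable_EFinP/measurable_indic.
    exact: measurableC.
  apply: ge0_le_integral => //.
  - by move=> x _; rewrite lee_fin normc2_ge0.
  - apply: measurable_normc2; apply: cmeasurableM => //.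
    exact: cmeasurable_character.
  - by apply: emeasurable_funD.
  move=> x _; rewrite normc2M normc2_character mul1r -EFinM -EFinD lee_fin.
  rewrite normc2_character_sub1 indicE.
  have [Gx|nGx] := pselect (G k x).
    rewrite memNset => [|/(_ Gx)//]; rewrite mulr0 addr0.
    have : ball (0 : R) eta (2 * pi * dot y x).
      have p2 : 0 <= 2 * pi :> R by rewrite mulr_ge0 ?pi_ge0.
      rewrite -ball_normE /= sub0r normrN normrM (ger0_norm p2).
      apply: le_lt_trans hy.
      have := normr_dot_le y x; have : `|x : 'cV[R]_d| <= k%:R + 1.
        by rewrite (le_trans (ltW Gx))// lerDl.
      move=> xk dk.
      have : `|dot y x| <= `|y| * ((d%:R + 1) * (k%:R + 1)).
        apply: le_trans dk _; rewrite [d%:R * _]mulrC -mulrA ler_wpM2l//.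
        by rewrite ler_pM ?ler0n// lerDl.
      by move=> h; have := ler_wpM2l p2 h; lra.
    move=> /heta; rewrite cos0 => /(le_lt_trans (ler_norm _)); lra.
  rewrite mem_set// mulr1.
  have := cos_geN1 (2 * pi * dot y x); lra.
apply: le_trans bound _.
rewrite ge0_integralD//; last 2 first.
- by move=> x _; rewrite lee_fin ltW// divr_gt0.
- apply: emeasurable_funM => //; apply/measurable_EFinP/measurable_indic.
  exact: measurableC.
rewrite integral_cst//= probability_setT mule1 ge0_integralZl//; last first.
  by apply/measurable_EFinP/measurable_indic; exact: measurableC.
rewrite integral_indic//; last exact: measurableC.
rewrite setIT; have -> : e%:E = ((e / 2)%:E + 4%:E * (e / 8)%:E)%E.
  by rewrite -EFinM -EFinD; congr EFin; field.
by rewrite leeD2l// lee_wpmul2l.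
Qed.

End FourierTransform.

(** * Integer shifts away from the zeros of the Fourier transform *)

Section FourierShift.
Context {R : realType} {d : nat}.
Variable mu : probability (borel R d) R.
Hypothesis mu_zeros : periodic_zeros mu = set0.

(** At each point of the cube some shift gives a nonzero value, and by continuity the same shift
    serves a neighbourhood; compactness makes the threshold [n.+1%:R^-1] uniform. *)
Lemma fourier_shift_cube : exists2 delta : R, 0 < delta &
  forall xi : 'cV[R]_d, (forall i, 0 <= xi i ord0 <= 1) ->
  exists k, delta <= normc2 (fourier mu (xi + zvec R k)).
Proof.
pose K := [set v : 'rV[R]_d | forall i, v ord0 i \in `[0, 1]].
have cK : compact K.
  apply: (@rV_compact _ _ (fun=> `[(0 : R), (1 : R)]%classic)) => _.
  exact: segment_compact.
pose P (n : nat) (v : 'rV[R]_d) :=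
  exists k, n.+1%:R^-1 <= normc2 (fourier mu (v^T + zvec R k)).
have : \forall n \near \oo, K `<=` P n.
  apply: (compact_near_coveringP K).1 => // v _.
  have [k Fk] : exists k, fourier mu (v^T + zvec R k) != 0.
    have : ~ periodic_zeros mu v^T by rewrite mu_zeros.
    by move=> /existsNP[k /eqP Fk]; exists k.
  set s := normc2 (fourier mu (v^T + zvec R k)).
  have s0 : 0 < s by rewrite lt_neqAle eq_sym normc2_eq0 Fk normc2_ge0.
  (* A deviation of at most [s / 8] leaves at least [3 * s / 8] at nearby points by [normc2_le2],
     enough for the value [s / 4] used below. *)
  have s8 : 0 < s / 8 by rewrite divr_gt0.
  have [rho rho0 hrho] := fourier_uniform mu s8.
  have s4 : 0 < s / 4 by rewrite divr_gt0.
  near=> v' n => /=; exists k.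
  have vv' : `|(v^T - v'^T : 'cV[R]_d)| < rho.
    apply: mx_norm_lt => // i j; rewrite !mxE ord1.
    have : `|v - v'| < rho by near: v'; apply: cvgr_dist_lt.
    apply: le_lt_trans; rewrite [leRHS]mx_normrE; apply/bigmax_geP; right.
    by exists (ord0, i) => //=; rewrite !mxE.
  have := hrho _ vv' (v'^T + zvec R k).
  have -> : v'^T + zvec R k + (v^T - v'^T) = v^T + zvec R k.
    by rewrite addrC addrA subrK.
  move=> h.
  have := normc2_le2 (fourier mu (v^T + zvec R k)) (fourier mu (v'^T + zvec R k)).
  rewrite -/s => h2.
  apply: (@le_trans _ _ (s / 4)); last by lra.
  near: n; exists (Num.trunc (s / 4)^-1) => // n /= hn.
  rewrite invf_ple ?posrE//; apply: ltW; apply: lt_le_trans (truncnS_gt _) _.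
  by rewrite ler_nat ltnS.
move=> [n _ /(_ n (leqnn n)) hn].
exists n.+1%:R^-1; first by rewrite invr_gt0.
move=> xi hxi; have [|k hk] := hn xi^T.
  by move=> i /=; rewrite mxE in_itv /=; exact: hxi.
by exists k; rewrite trmxK in hk.
Unshelve. all: by end_near.
Qed.

(** The condition [s 0 = 0], which keeps 0 among the frequencies and so makes the frames nested, is
    available since the transform is 1 at 0 and the threshold [m] is at most 1. Perturbation by [y]
    costs the factor 4. *)
Lemma fourier_shift : exists delta rho : R, [/\ 0 < delta, delta <= 1, 0 < rho &
  exists s : 'cV[R]_d -> 'cV[int]_d, s 0 = 0 /\
    forall xi y, `|y| < rho ->
      delta <= normc2 (fourier mu (xi + zvec R (s xi) + y))].
Proof.
have [delta0 delta0_gt0 cube] := fourier_shift_cube.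
pose m := Num.min delta0 1.
have m0 : 0 < m by rewrite lt_min delta0_gt0 ltr01.
have m1 : m <= 1 by rewrite ge_min lexx orbT.
have m4 : 0 < m / 4 by rewrite divr_gt0.
have [rho rho0 hrho] := fourier_uniform mu m4.
have pick (xi : 'cV[R]_d) : exists k : 'cV[int]_d,
    (xi = 0 -> k = 0) /\ m <= normc2 (fourier mu (xi + zvec R k)).
  have [->|xi0] := eqVneq xi 0.
    by exists 0; split => //; rewrite zvec0 addr0 fourier0 normc2_1.
  (* Subtracting integer parts brings [xi] into the cube; the shift found there is corrected by the
     same vector. *)
  pose fl : 'cV[int]_d := \col_i Num.floor (xi i ord0).
  have [|k hk] := cube (xi - zvec R fl).
    move=> i; rewrite !mxE.
    have /andP[lo hi] := Num.Theory.real_floor_itv (num_real (xi i ord0)).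
    rewrite subr_ge0 lo /= lerBlDl; apply: ltW.
    by rewrite (lt_le_trans hi)// intrD.
  exists (k - fl); split; first by move/eqP: xi0.
  rewrite zvecD zvecN [zvec R k - _]addrC addrA (le_trans _ hk)//.
  by rewrite ge_min lexx.
have [s hs] := choice pick.
exists (m / 4), rho; split => //; first by lra.
exists s; split; first by have [-> //] := hs 0.
move=> xi y yrho; have [_ h1] := hs xi.
have h2 := hrho _ yrho (xi + zvec R (s xi)).
have := normc2_le2 (fourier mu (xi + zvec R (s xi)))
  (fourier mu (xi + zvec R (s xi) + y)).
rewrite -[X in normc2 X <= _]opprB normc2N in h2 *; lra.
Qed.

End FourierShift.

(** * The increasing sequence of frames *)

Section Tower.
Context {R : realType} {d : nat}.
Variables (M : 'M[int]_d) (B : {fset 'cV[int]_d}).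
Variable mu : probability (borel R d) R.
Local Notation A := (invmx (zmat R M)).
Local Notation Z := (zmat R M).
Hypothesis M_exp : expansive R M.
Hypothesis B_simple : simple_digit_set M B.
Hypothesis mu_MB : self_affine M B mu.
Hypothesis MB_parseval : almost_parseval_frame R M B.
Let M_unit : Z \in unitmx := expansive_unit M_exp.
Variables (delta rho : R) (s : 'cV[R]_d -> 'cV[int]_d).
Hypothesis rho_gt0 : 0 < rho.
Hypothesis s0 : s 0 = 0.
Hypothesis s_delta : forall xi y, `|y| < rho ->
  delta <= normc2 (fourier mu (xi + zvec R (s xi) + y)).

Lemma near_all_seq (T : eqType) (P : T -> nat -> Prop) (l : seq T) :
  (forall x, \forall n \near \oo, P x n) ->
  \forall n \near \oo, forall x, x \in l -> P x n.
Proof.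
move=> h; elim: l => [|y l ih]; first by near=> n.
near=> n => x; rewrite inE => /orP[/eqP ->|].
  by near: n; exact: h.
by move: x; near: n; exact: ih.
Unshelve. all: by end_near.
Qed.

Lemma tower_step m (L : seq 'cV[int]_d) (a a' a1 a1' : R) :
  0 < a1 -> a1 < a -> 0 < a' -> a' < a1' ->
  0 \in L -> digit_frame M B m L a a' ->
  exists m' L', [/\ (m < m')%N, {subset L <= L'}, 0 \in L',
    digit_frame M B m' L' a1 a1' &
    forall l, l \in L' ->
      delta <= normc2 (fourier mu ((A ^+ m')^T *m zvec R l))].
Proof.
move=> a1_gt0 a1a a'_gt0 a'a1' L0 hL.
have a_gt0 : 0 < a by exact: lt_trans a1a.
have [eps [eps0 eps1 hlo hhi]] : exists eps : R,
    [/\ 0 < eps, eps < 1, a1 <= a * (1 - eps) & a' * (1 + eps) <= a1'].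
  (* The first entry gives [eps < 1]; the other two are the relative losses permitted in the lower
     and the upper constant. *)
  pose e := Num.min (1 / 2) (Num.min ((a - a1) / a) ((a1' - a') / a')).
  have e0 : 0 < e by rewrite !lt_min !divr_gt0 ?subr_gt0//.
  have /and3P[e1 e2 e3] : [&& e <= 1 / 2, e <= (a - a1) / a & e <= (a1' - a') / a'].
    by rewrite !ge_min !lexx /= !orbT.
  move: e2 e3; rewrite !ler_pdivlMr// => e2 e3.
  by exists e; split; lra.
have [p _ hp] := near_all_seq (P := fun l n => `|(A ^+ n)^T *m zvec R l| < rho)
  L (fun l => filterS (fun n h => proj2 h) (expansive_mulmx_lt (zvec R l) M_exp rho_gt0)).
have [n [J [pn hJ]]] :=
  digit_frame_large M_unit B_simple (B_gt0 mu_MB) p eps0 eps1 MB_parseval.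
have [l0 l0J] : exists l0, l0 \in J.
  by apply: (digit_frame_neq0 M_unit B_simple (B_gt0 mu_MB) _ hJ); lra.
pose J0 := [seq l + - l0 | l <- J].
have J00 : 0 \in J0 by apply/mapP; exists l0; rewrite ?subrr.
(* The integer shift depends on the new frequency only; the old one will enter as a perturbation
   smaller than [rho]. *)
pose t l := s ((A ^+ n)^T *m zvec R l).
pose J1 := [seq l + (M ^+ n)^T *m t l | l <- J0].
have J10 : 0 \in J1.
  by apply/mapP; exists 0; rewrite // /t zvec0 mulmx0 s0 mulmx0 addr0.
have hJ1 : digit_frame M B n J1 (1 - eps) (1 + eps).
  by apply: digit_frame_shift => //; exact: digit_frame_translate.
pose L' := [seq l + (M ^+ m)^T *m l' | l <- L, l' <- J1].
have LL' : {subset L <= L'}.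
  by move=> l lL; apply/allpairsP; exists (l, 0); rewrite /= mulmx0 addr0.
exists (m + n)%N, L'; split => //.
- by rewrite -{1}[m]addn0 ltn_add2l (leq_ltn_trans (leq0n p) pn).
- exact: LL'.
- apply: (digit_frame_weaken hlo hhi).
  by apply: digit_frame_combine => //; lra.
move=> _ /allpairsP[[l l'] /= [lL /mapP[l1 l1J ->] ->]].
rewrite !zvecD !zvec_mulmx zvecD zvec_mulmx !zmatT !zmatX.
(* The transposed inverse power cancels [M ^+ m] and then [M ^+ n], leaving [y], [(A ^+ n)^T *m l1]
   and the integer vector [t l1]. *)
set y := (A ^+ (m + n))^T *m zvec R l.
rewrite mulmxDr -/y mulmxA -trmx_mul exprD mulmxA mulXVmx// mul1mx.
rewrite mulmxDr [(A ^+ n)^T *m (_ *m _)]mulmxA -trmx_mul mulXVmx// trmx1 mul1mx.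
rewrite addrC; apply: s_delta; apply: hp => //=.
exact: leq_trans (ltnW pn) (leq_addl _ _).
Qed.

Hypothesis delta_le1 : delta <= 1.

Lemma digit_frame0 : digit_frame M B 0 [:: 0] 1 (1 : R).
Proof.
move=> w /=; rewrite big_seq1.
have -> : iterated_digits M B 0 = [fset 0]%fset.
  by apply/fsetP => b; rewrite iterated_digits0 inE.
rewrite !big_seq_fset1 expn0 !mul1r zvec0 character0r mulr1.
by rewrite lexx.
Qed.

Lemma tower : exists (m : nat -> nat) (L : nat -> seq 'cV[int]_d), forall k,
  [/\ (k <= m k)%N, {subset L k <= L k.+1},
    digit_frame M B (m k) (L k) (1 / 2) (3 / 2 : R) &
    forall l, l \in L k ->
      delta <= normc2 (fourier mu ((A ^+ m k)^T *m zvec R l))].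
Proof.
(* Strictly decreasing, so each step has room to lose; starting at 1/3 lets the exact frame with
   constants 1 satisfy the invariant at level 0. *)
pose e k : R := k.+3%:R^-1.
have e0 k : 0 < e k by rewrite invr_gt0.
have eS k : e k.+1 < e k by rewrite ltf_pV2 ?posrE// ltr_nat.
have e3 k : e k < 1 / 2.
  by rewrite mul1r ltf_pV2 ?posrE// ltr_nat.
pose Inv k (st : nat * seq 'cV[int]_d) := [/\ (k <= st.1)%N, 0 \in st.2,
  digit_frame M B st.1 st.2 (1 / 2 + e k) (3 / 2 - e k) &
  forall l, l \in st.2 ->
    delta <= normc2 (fourier mu ((A ^+ st.1)^T *m zvec R l))].
(* [choice] needs a successor for every state, so the invariant is a premise and any other state
   keeps a dummy successor. *)
have step (kst : nat * (nat * seq 'cV[int]_d)) : exists st',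
    Inv kst.1 kst.2 -> Inv kst.1.+1 st' /\ {subset kst.2.2 <= st'.2}.
  case: kst => k [m L] /=.
  have [[km L0 hL _]|nI] := pselect (Inv k (m, L)); last by exists (m, L) => /nI.
  have [m' [L' [mm' LL' L'0 hL' hd]]] :
    exists m' L', [/\ (m < m')%N, {subset L <= L'}, 0 \in L',
      digit_frame M B m' L' (1 / 2 + e k.+1) (3 / 2 - e k.+1) &
      forall l, l \in L' ->
        delta <= normc2 (fourier mu ((A ^+ m')^T *m zvec R l))].
    apply: tower_step L0 hL.
    - by have := e0 k.+1; lra.
    - by have := eS k; lra.
    - by have := e3 k; lra.
    - by have := eS k; lra.
  exists (m', L') => _; split => //; split => //=.
  exact: leq_ltn_trans mm'.
have [F hF] := choice step.
pose st := fix st k := if k is k'.+1 then F (k', st k') else (0%N, [:: 0]).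
have I0 : Inv 0%N (st 0%N).
  split => /=; [by []|by rewrite mem_seq1| |].
  - apply: (digit_frame_weaken _ _ digit_frame0).
      by have := e3 0%N; lra.
    by have := e3 0%N; lra.
  (* The initial frequency is 0, where the transform is 1: [delta <= 1] is used here. *)
  - move=> l; rewrite inE => /eqP ->.
    by rewrite zvec0 mulmx0 fourier0 normc2_1.
have I k : Inv k (st k).
  elim: k => [//|k ih].
  by have [] := hF (k, st k) ih.
exists (fun k => (st k).1), (fun k => (st k).2) => k.
have [km _ hL hd] := I k; split => //.
- by have [_] := hF (k, st k) (I k).
- by apply: (digit_frame_weaken _ _ hL); have := e0 k; lra.
Qed.

End Tower.

(** * Sums over the union of the frames, and the theorem *)

Lemma esum_seq_le (R : realType) (T : choiceType) (S : set T) (g : T -> \bar R)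
    (r : seq T) : uniq r -> [set` r] `<=` S ->
  (\sum_(x <- r) g x <= \esum_(x in S) g x)%E.
Proof.
move=> ur rS; rewrite fsbig_seq//; apply: esum_ge.
by exists [set` r] => //; split => //; exact: finite_seq.
Qed.

(** The sum is a supremum over finite subsets, and a finite subset of an increasing union lies in
    one of the lists. *)
Lemma esum_bigcup_seq_le (R : realType) (T : choiceType) (g : T -> \bar R)
    (r : nat -> seq T) (C : \bar R) : (forall x, 0 <= g x)%E ->
  (forall k, uniq (r k)) -> (forall k, {subset r k <= r k.+1}) ->
  (forall k, (\sum_(x <- r k) g x <= C)%E) ->
  (\esum_(x in \bigcup_k [set` r k]) g x <= C)%E.
Proof.
move=> g0 ur rS hC; apply: ge_ereal_sup => _ [X [finX XS] <-].
have mono k l : (k <= l)%N -> {subset r k <= r l}.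
  move=> /subnKC <-; elim: (l - k)%N => [|i ih]; first by rewrite addn0.
  by rewrite addnS => x /ih; exact: rS.
have [k Xk] : exists k, X `<=` [set` r k].
  have /finite_seqP[q Xq] := finX.
  have : forall x, x \in q -> exists k, x \in r k.
    move=> x xq; have /XS[k _ xk] : X x by rewrite Xq.
    by exists k.
  suff : (forall x, x \in q -> exists k, x \in r k) -> exists k, {subset q <= r k}.
    by move=> /[apply] -[k hk]; exists k; rewrite Xq => x; exact: hk.
  move=> {Xq}; elim: q => [|y q ih] h; first by exists 0%N.
  have [|k hk] := ih; first by move=> x xq; apply: h; rewrite inE xq orbT.
  have [l hl] := h y (mem_head _ _).
  exists (maxn k l) => x; rewrite inE => /orP[/eqP ->|/hk].
    exact: mono (leq_maxr k l) _ hl.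
  exact: mono (leq_maxl k l) _.
apply: le_trans (hC k).
have -> : (\sum_(x <- r k) g x = \sum_(x \in [set` r k]) g x)%E by rewrite fsbig_seq.
apply: lee_fsum_nneg_subset => //.
by move=> x /= /set_mem xX; apply/mem_set; exact: Xk.
Qed.

Theorem theorem1p9 (R : realType) (d : nat) (M : 'M[int]_d)
    (B : {fset 'cV[int]_d}) (mu : probability (borel R d) R)
    (M_expansive : expansive R M)
    (B_simple : simple_digit_set M B)
    (MB_almost_parseval : almost_parseval_frame R M B)
    (mu_MB : self_affine M B mu)
    (mu_zeros : periodic_zeros mu = set0) :
  exists L : set 'cV[R]_d,
    L `<=` range (@zvec R d) /\ fourier_frame mu L.
Proof.
have M_unit := expansive_unit M_expansive.
have [delta [rho [delta0 delta1 rho0 [s [s0 s_delta]]]]] := fourier_shift mu_zeros.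
have [m [L hL]] :=
  tower M_expansive B_simple mu_MB MB_almost_parseval rho0 s0 s_delta delta1.
pose r k := [seq zvec R l | l <- L k].
have ur k : uniq (r k).
  have [_ _ hk _] := hL k; rewrite map_inj_uniq; last exact: zvec_inj.
  by apply: (digit_frame_uniq M_unit B_simple (B_gt0 mu_MB) _ hk); lra.
have rS k : {subset r k <= r k.+1}.
  by move=> _ /mapP[l lL ->]; have [_ sub _ _] := hL k; exact/map_f/sub.
exists (\bigcup_k [set` r k]); split.
  by move=> x [k _ /= /mapP[l _ ->]]; exists l.
(* [lower_bound] with [a = 1 / 2] yields [delta / 4] against twice the sum, hence [delta / 8]. *)
exists (delta / 8), (3 / 2); split; [by rewrite divr_gt0|by lra|].
move=> f sf.
pose g (x : 'cV[R]_d) : \bar R :=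
  (normc2 (cintegral mu (fun y => f y * character x y)))%:E.
have sumE k : (\sum_(x <- r k) g x)%E = (\sum_(l <- L k) normc2
    (cintegral mu (fun x => f x * character (zvec R l) x)))%:E.
  by rewrite /r big_map sumEFin.
split.
  rewrite -/g; set S := esum _ _.
  have [->|Soo] := eqVneq S +oo%E; first exact: leey.
  have S0 : (0 <= S)%E by apply: esum_ge0 => x _; rewrite lee_fin normc2_ge0.
  have Sfin : S \is a fin_num by rewrite ge0_fin_numE// ltey.
  have [mf foo] := (square_integrableP mu f).1 sf.
  have ffin : sqnorm mu f \is a fin_num.
    by rewrite ge0_fin_numE//; exact: sqnorm_ge0.
  rewrite -(fineK Sfin) -(fineK ffin) -EFinM lee_fin.
  apply/ler_addgt0Pl => e e0.
  have [_ happ] := approximable_square_integrable M_expansive B_simple mu_MB sf.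
  (* The error term is [(3 + delta / 2) * (e / 4)], half of which is below [e]. Approximation holds
     at all levels from [K] on, in particular at [m K], which is at least [K]. *)
  have [K _ hK] := happ (e / 4) (divr_gt0 e0 (ltr0n _ 4)).
  have [Km _ hk hd] := hL K.
  have [w hw] := hK _ Km.
  have := lower_bound M_unit B_simple mu_MB _ _ (ltW delta0) hk sf hd hw.
  have half0 : (0 : R) <= 1 / 2 by lra.
  have th0 : (0 : R) <= 3 / 2 by lra.
  move=> /(_ half0 th0).
  rewrite -(fineK ffin) -EFinM lee_fin => h.
  have : (\sum_(x <- r K) g x <= S)%E.
    by apply: esum_seq_le (ur K) _ => x xr; exists K.
  rewrite sumE -(fineK Sfin) lee_fin => h2.
  have : delta * (e / 4) <= e / 4 by rewrite ler_piMl// divr_ge0// ltW.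
  lra.
apply: esum_bigcup_seq_le => // [x|k]; first by rewrite lee_fin normc2_ge0.
have [_ _ hk _] := hL k; rewrite sumE.
by apply: upper_bound hk sf => //; lra.
Qed.
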